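(* Let $f:\Omega\to\mathbb{R}$ be a Lipschitz potential of product type, $f(x)=\sum_{j=1}^{\infty} f_j(x_j)$, where $f_j:[0,1]\to\mathbb{R}$ are fixed functions, the series converges absolutely for every $x\in\Omega=[0,1]^{\mathbb{N}}$, and the iterated series $\sum_{j=1}^{\infty}\sum_{i>j} f_i(x_j)$ converges (to a finite real number) for every $x\in\Omega$. Let $F(b)=f(b,b,b,\dots)=\sum_{i=1}^{\infty} f_i(b)$ and suppose that $F(b)$, $F'(b)$ and $F''(b)$ are real and continuous in $0\le b\le 1$. For $\beta>0$ let $\tilde\mu_{\beta}=\bigotimes_{n=1}^{\infty}\tilde\mu_{0,\beta}$, where $\tilde\mu_{0,\beta}$ is the probability measure on $[0,1]$ given by $$d\tilde\mu_{0,\beta}(a)=\frac{e^{\beta F(a)}}{\int_0^1 e^{\beta F(b)}\,db}\,da .$$ (a) Suppose $F$ attains its maximum over $[0,1]$ at exactly one point $a_1$, and $a_1\in(0,1)$. Then $\lim_{\beta\to\infty}\tilde\mu_{0,\beta}=\delta_{a_1}$ and $\lim_{\beta\to\infty}\tilde\mu_{\beta}=\bigotimes_{n=1}^{\infty}\delta_{a_1}$. (b) Suppose $F$ attains its maximum over $[0,1]$ at exactly two points $a_1,a_2$, with $0<a_1<a_2<1$. Then $\lim_{\beta\to\infty}\tilde\mu_{0,\beta}=\tilde\mu_{0,\infty}=p_1\delta_{a_1}+p_2\delta_{a_2}$ and $\lim_{\beta\to\infty}\tilde\mu_{\beta}=\bigotimes_{n=1}^{\infty}(p_1\delta_{a_1}+p_2\delta_{a_2})$,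 where $$p_1+p_2=1,\qquad \frac{p_1}{p_2}=\sqrt{\frac{F''(a_2)}{F''(a_1)}} .$$ All limits are in the weak* topology.
   Context: $\Omega=[0,1]^{\mathbb{N}}$ is equipped with the metric $d(x,y)=\sum_{n\ge1}|x_n-y_n|/2^n$, and Lipschitz is with respect to $d$. $\delta_a$ is the Dirac mass at $a$, and $da$, $db$ denote Lebesgue measure on $[0,1]$. The probability $\tilde\mu_\beta$ is the equilibrium probability for the potential $\beta f$ (inverse temperature $\beta$). Iterated sums $\sum_j\sum_{i>j}$ mean: first sum over $i>j$, then over $j$.
   Formalization: In (b) it is assumed that F''(a_1) and F''(a_2) are not both zero, since otherwise the ratio F''(a_2)/F''(a_1) is 0/0 and undefined; if only F''(a_1)=0, the infinite ratio p_1/p_2 is read as p_2=0. *)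

(* Defs.v *)
From HB Require Import structures.
From mathcomp Require Import all_boot all_order all_algebra.
From mathcomp Require Import all_classical all_reals all_analysis.

Set Implicit Arguments.
Unset Strict Implicit.
Unset Printing Implicit Defensive.

Import Order.TTheory GRing.Theory Num.Theory.
Import numFieldNormedType.Exports.

Local Open Scope classical_set_scope.
Local Open Scope ring_scope.

#[short(type="topMeasurableType")]
HB.structure Definition TopMeasurable (d : measure_display) :=
  { T of Measurable d T & Topological T }.

(* The interval [0,1], with the subspace topology and the trace of the Borel
   sigma-algebra of R. *)
Definition unitI (R : realType) : Type := set_type (`[0%R, 1%R]%classic : set R).

Section unit_interval.
Variable R : realType.

Definition unitI_val (x : unitI R) : R := set_val x.

HB.instance Definition _ := PseudoMetric.copy (unitI R)
  (set_type (`[0%R, 1%R]%classic : set R)).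

Let zero_in_unitI : (0 : R) \in (`[0%R, 1%R]%classic : set R).
Proof. by apply/mem_set; rewrite /= in_itv/= lexx ler01. Qed.

HB.instance Definition _ :=
  isPointed.Build (unitI R) (exist _ (0 : R) zero_in_unitI : unitI R).

Let msets : set_system (unitI R) :=
  preimage_set_system setT unitI_val (@measurable _ R).

Let msalg : sigma_algebra setT msets.
Proof. exact/sigma_algebra_preimage/sigma_algebra_measurable. Qed.

Let msets0 : msets set0. Proof. by case: msalg. Qed.
Let msetsC A : msets A -> msets (~` A).
Proof. by case: msalg => _ + _ => /(_ A) h /h; rewrite setTD. Qed.
Let msetsU (F : (set (unitI R))^nat) :
  (forall i, msets (F i)) -> msets (\bigcup_i F i).
Proof. by case: msalg => _ _; exact. Qed.

HB.instance Definition _ := @isMeasurable.Build default_measure_display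
  (unitI R) msets msets0 msetsC msetsU.

Lemma unitI_val_inj : injective unitI_val.
Proof. by move=> x y; exact: val_inj. Qed.

Lemma measurable_unitI_val_image (A : set (unitI R)) :
  measurable A -> measurable (unitI_val @` A).
Proof.
case=> B mB; rewrite setTI => <-.
rewrite (_ : _ @` _ = B `&` `[0%R, 1%R]); first exact: measurableI.
apply/seteqP; split => [_ [x Bx <-]|r [Br r01]].
  by split => //; exact/set_mem/(valP x).
by exists (exist _ r (mem_set r01) : unitI R).
Qed.

Definition lebesgue01 (A : set (unitI R)) : \bar R :=
  lebesgue_measure (unitI_val @` A).

Let lebesgue01_0 : lebesgue01 set0 = 0%E.
Proof. by rewrite /lebesgue01 image_set0 measure0. Qed.

Let lebesgue01_ge0 A : (0 <= lebesgue01 A)%E.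
Proof. exact: measure_ge0. Qed.

Let lebesgue01_sigma_additive : semi_sigma_additive lebesgue01.
Proof.
move=> F mF tF mUF; rewrite /lebesgue01 image_bigcup.
apply: measure_semi_sigma_additive.
- by move=> i; exact: measurable_unitI_val_image.
- move=> i j _ _ [_ [[x Fix <-] [y Fjy /unitI_val_inj yx]]].
  by apply: tF => //; exists x; split => //; rewrite -yx.
- by rewrite -image_bigcup; exact: measurable_unitI_val_image.
Qed.

HB.instance Definition _ := isMeasure.Build _ _ _ lebesgue01
  lebesgue01_0 lebesgue01_ge0 lebesgue01_sigma_additive.

Let lebesgue01_setT : lebesgue01 setT = 1%E.
Proof.
rewrite /lebesgue01 (_ : _ @` _ = `[0%R, 1%R]%classic).
  by rewrite lebesgue_measure_itv/= lte01 oppr0 adde0.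
apply/seteqP; split => [_ [x _ <-]|r r01]; first exact/set_mem/(valP x).
by exists (exist _ r (mem_set r01) : unitI R).
Qed.

HB.instance Definition _ := Measure_isProbability.Build _ _ _ lebesgue01
  lebesgue01_setT.

End unit_interval.

(* [0,1]^N, with coordinates numbered from 0, so that coordinate n has weight
   1 / 2^(n+1) in the metric. *)
Definition Omega (R : realType) : Type := nat -> unitI R.

Section Omega_structure.
Variable R : realType.
Implicit Types x y z : Omega R.

Let dist_term x y : R^nat :=
  fun n => `|unitI_val (x n) - unitI_val (y n)| / 2 ^+ n.+1.

Definition Omega_dist x y : R := limn (series (dist_term x y)).

Let dist_term_ge0 x y n : 0 <= dist_term x y n.
Proof. by rewrite divr_ge0// exprn_ge0. Qed.

Lemma is_cvg_Omega_dist x y : cvgn (series (dist_term x y)).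
Proof.
apply: (@series_le_cvg _ _ (geometric (2^-1) (2^-1))) => [n|n|n|] /=.
- exact: dist_term_ge0.
- by rewrite mulr_ge0// exprn_ge0.
- rewrite -exprS exprVn ler_piMl ?invr_ge0 ?exprn_ge0//.
  have /set_mem := valP (x n); have /set_mem := valP (y n).
  rewrite /= !in_itv/= -/(unitI_val _) => /andP[y0 y1] /andP[x0 x1].
  rewrite ler_norml; apply/andP; split.
    by rewrite lerBrDr (le_trans _ x0)// addrC subr_le0.
  by rewrite lerBlDr (le_trans x1)// lerDl.
- by apply: is_cvg_geometric_series; rewrite ger0_norm// invf_lt1// ltr1n.
Qed.

Let dist_xx x : Omega_dist x x = 0.
Proof.
rewrite /Omega_dist (_ : dist_term x x = fun=> 0).
  by rewrite (_ : series _ = fun=> 0) ?lim_cst//; apply/funext => n;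
    rewrite /series/= big1.
by apply/funext => n; rewrite /dist_term subrr normr0 mul0r.
Qed.

Let dist_eq0 x y : Omega_dist x y = 0 -> x = y.
Proof.
move=> xy0; apply/funext => n; apply: unitI_val_inj.
have : dist_term x y n <= 0.
  rewrite -xy0; apply: (@le_trans _ _ (series (dist_term x y) n.+1)).
    by rewrite seriesSr lerDr// sumr_ge0.
  apply: nondecreasing_cvgn_le; last exact: is_cvg_Omega_dist.
  by apply: nondecreasing_series => *; exact: dist_term_ge0.
rewrite /dist_term pmulr_lle0 ?invr_gt0 ?exprn_gt0// normr_le0 subr_eq0.
by move/eqP.
Qed.

Let dist_sym x y : Omega_dist x y = Omega_dist y x.
Proof.
rewrite /Omega_dist (_ : dist_term x y = dist_term y x)//.
by apply/funext => n; rewrite /dist_term distrC.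
Qed.

Let dist_triangle y x z : Omega_dist x z <= Omega_dist x y + Omega_dist y z.
Proof.
rewrite /Omega_dist -limD; [|exact: is_cvg_Omega_dist..].
apply: ler_lim; first exact: is_cvg_Omega_dist.
  by apply: is_cvgD; exact: is_cvg_Omega_dist.
apply: nearW => n.
rewrite -[leRHS]/(series (dist_term x y) n + series (dist_term y z) n).
rewrite /series/= -big_split/=; apply: ler_sum => i _.
by rewrite /dist_term -mulrDl ler_pM2r ?invr_gt0 ?exprn_gt0// ler_distD.
Qed.

HB.instance Definition _ := gen_eqMixin (Omega R).
HB.instance Definition _ := gen_choiceMixin (Omega R).
HB.instance Definition _ := isPointed.Build (Omega R) (fun=> point).
HB.instance Definition _ := @isMetric.Build R (Omega R) Omega_dist
  dist_xx dist_eq0 dist_sym dist_triangle.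

(* The product sigma-algebra. *)
Let msets : set_system (Omega R) :=
  <<s \bigcup_n preimage_set_system setT (fun x : Omega R => x n) measurable >>.

Let msets0 : msets set0. Proof. exact: sigma_algebra0. Qed.
Let msetsC A : msets A -> msets (~` A). Proof. exact: sigma_algebraC. Qed.
Let msetsU (F : (set (Omega R))^nat) :
  (forall i, msets (F i)) -> msets (\bigcup_i F i).
Proof. exact: sigma_algebra_bigcup. Qed.

HB.instance Definition _ := @isMeasurable.Build default_measure_display
  (Omega R) msets msets0 msetsC msetsU.

End Omega_structure.

Section definitions.
Variable R : realType.

Definition is_lipschitz (f : Omega R -> R) : Prop :=
  exists K : R, forall x y, `|f x - f y| <= K * mdist x y.

Definition is_product_type (f : Omega R -> R) (fj : nat -> unitI R -> R) : Prop :=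
  forall x, cvgn (series (fun j => `|fj j (x j)|)) /\
            series (fun j => fj j (x j)) @ \oo --> f x.

(* The inner series runs over i > j, reindexed by i = j + 1 + k. *)
Definition iterated_series_cvg (fj : nat -> unitI R -> R) : Prop :=
  forall x : Omega R,
    (forall j, cvgn (series (fun k => fj (j.+1 + k)%N (x j)))) /\
    cvgn (series (fun j => limn (series (fun k => fj (j.+1 + k)%N (x j))))).

Definition on_diagonal (f : Omega R -> R) (b : unitI R) : R := f (fun=> b).

(* One-sided at the end points, since y ranges over [0,1]. *)
Definition is_derivative01 (F F' : unitI R -> R) : Prop :=
  forall x : unitI R,
    (F y - F x) / (unitI_val y - unitI_val x) @[y --> x^'] --> F' x.

Definition has_density (nu : {measure set (unitI R) -> \bar R})
    (h : unitI R -> R) : Prop :=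
  forall A, measurable A -> nu A = (\int[lebesgue01 (R:=R)]_(a in A) (h a)%:E)%E.

(* P is the product of countably many copies of the probability measure nu:
   these values on rectangles determine P, by uniqueness of measures. *)
Definition is_product_power (nu : {measure set (unitI R) -> \bar R})
    (P : {measure set (Omega R) -> \bar R}) : Prop :=
  forall (n : nat) (A : nat -> set (unitI R)), (forall i, measurable (A i)) ->
    P [set x | forall i, (i < n)%N -> A i (x i)] = (\prod_(i < n) nu (A i))%E.

(* Every continuous function on the compact spaces [0,1] and [0,1]^N is bounded
   and measurable, so that the integrals below are the genuine ones. *)
Definition weak_star_cvg (d : measure_display) (T : topMeasurableType d)
    (mu : R -> probability T R) (m : {measure set T -> \bar R}) : Prop :=
  forall g : T -> R, continuous g ->
    \int[mu b]_x g x @[b --> +oo] --> \int[m]_x g x.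

Definition is_max_point (F : unitI R -> R) (a : unitI R) : Prop :=
  forall b, F b <= F a.

End definitions.

(* Main.v *)
Require Import Defs.
From mathcomp Require Import all_boot all_order all_algebra.
From mathcomp Require Import all_classical all_reals all_analysis.
From mathcomp Require Import measurable_realfun ring lra.

Set Implicit Arguments.
Unset Strict Implicit.
Unset Printing Implicit Defensive.

Import Order.TTheory GRing.Theory Num.Theory.
Import numFieldNormedType.Exports.

Local Open Scope classical_set_scope.
Local Open Scope ring_scope.

(** Both parts are the Laplace principle for the Gibbs measures
    [exp(beta F) / Z], carried over to the infinite product.

    Since [F] is continuous on a compact interval, the mass of a closed set
    containing no maximizer decays like [exp(- beta eta)]
    ([gibbs_mass_vanishes]): the measure concentrates near the maximizers.

    With two maximizers, the ratio of the masses of their neighbourhoods is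
    found without evaluating any Gaussian integral. Let [a] and [a'] be the
    maximizers. If [k > 0] and [k ^ 2 F''(a') < F''(a)], then
    [t |-> F(a + t) - F(a' + k t)] has a strictly positive second derivative at
    its critical point [0], so that [F(a' + k t) <= F(a + t)] for small [t]
    ([compare_near_critical]); an affine change of variables then bounds the
    mass of the interval of radius [k d] around [a'] by [k] times the mass of
    the interval of radius [d] around [a] ([gibbs_mass_scaled]). Letting [k]
    decrease to [sqrt(- F''(a)) / sqrt(- F''(a'))], and exchanging [a] and [a'],
    gives lower bounds for the two limit masses ([gibbs_mass_lower]) that add
    up to [1], hence are the limits. This covers the case where one of the two
    second derivatives vanishes.

    Weak convergence is deduced from convergence of the masses of the cells of
    finite partitions ([cvg_Rintegral_oscillation]). On [0,1] the cells are the
    neighbourhoods of the maximizers and the remaining set, which is null for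
    the limit. On the product they are the cylinders over words in these cells:
    their masses are finite products, and a continuous function oscillates
    little on each cylinder of positive mass, because the product of copies of
    [0,1] is compact and the tail coordinates contribute little to the metric.
*)

(** * Weak convergence tested on finite partitions *)

(** A finite measurable partition is given by the map [kappa] that sends a
    point to the index of its cell. *)
Section finite_classifier.
Context d (T : measurableType d) (R : realType) (I : finType) (kappa : T -> I).
Hypothesis mkappa : forall i, measurable (kappa @^-1` [set i]).

Lemma measurable_classifier (Y : set I) : measurable (kappa @^-1` Y).
Proof.
have -> : kappa @^-1` Y = \bigcup_(i in Y) (kappa @^-1` [set i]).
  apply/seteqP; split => [x Yx|x [i Yi /= ->]//].
  by exists (kappa x).
exact: (fin_bigcup_measurable finite_finset).
Qed.

Lemma measurable_fun_classifier (c : I -> R) :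
  measurable_fun setT (c \o kappa).
Proof.
by move=> _ Y _; rewrite setTI; exact: (measurable_classifier (c @^-1` Y)).
Qed.

Variable m : {measure set T -> \bar R}.
Hypothesis m_fin : (m setT < +oo)%E.

Lemma integrable_classifier (c : I -> R) :
  m.-integrable setT (EFin \o (c \o kappa)).
Proof.
apply: measurable_bounded_integrable => //.
  exact: measurable_fun_classifier.
exists (\sum_i `|c i|); split; first by rewrite num_real.
move=> M ltM x _ /=; apply: le_trans (ltW ltM).
by rewrite (bigD1 (kappa x))//= lerDl sumr_ge0.
Qed.

Lemma Rintegral_classifier (c : I -> R) :
  \int[m]_x c (kappa x) = \sum_i c i * fine (m (kappa @^-1` [set i])).
Proof.
have kT : \big[setU/set0]_(i <- index_enum I) (kappa @^-1` [set i]) = setT.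
  apply/seteqP; split => // x _.
  by rewrite -bigcup_seq; exists (kappa x) => //=; rewrite mem_index_enum.
rewrite /Rintegral -[in LHS]kT integral_bigsetU_EFin//=.
- rewrite -sum_fine; last first.
    move=> i _; rewrite (eq_integral (cst (c i)%:E)) ?integral_cst//.
      rewrite fin_numM// ge0_fin_numE//; apply: le_lt_trans m_fin.
      by apply: le_measure => //; rewrite inE.
    by move=> x; rewrite inE => /= ->.
  apply: eq_bigr => i _.
  by rewrite -Rintegral_cst//; apply: eq_Rintegral => x; rewrite inE => /= ->.
- exact: index_enum_uniq.
- by move=> i j _ _ [x [/= <- <-]].
- by apply/measurable_EFinP; rewrite kT; exact: measurable_fun_classifier.
Qed.

Lemma Rintegral_near_classifier (g : T -> R) (c e : I -> R) :
  measurable_fun setT g ->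
  (forall x, `|g x - c (kappa x)| <= e (kappa x)) ->
  `|\int[m]_x g x - \sum_i c i * fine (m (kappa @^-1` [set i]))|
    <= \sum_i e i * fine (m (kappa @^-1` [set i])).
Proof.
move=> mg gce.
have ig : m.-integrable setT (EFin \o g).
  apply: measurable_bounded_integrable => //.
  exists (\sum_i (`|c i| + `|e i|)); split; first by rewrite num_real.
  move=> M ltM x _ /=; apply: le_trans (ltW ltM).
  apply: (@le_trans _ _ (`|c (kappa x)| + `|e (kappa x)|)).
    rewrite -[g x](subrK (c (kappa x))) addrC (le_trans (ler_normD _ _))//.
    by rewrite lerD2l (le_trans (gce x))// ler_norm.
  by rewrite [leRHS](bigD1 (kappa x))//= lerDl sumr_ge0.
rewrite -!Rintegral_classifier -RintegralB//; last exact: integrable_classifier.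
apply: le_trans (le_normr_Rintegral _ _) _ => //.
  exact: (integrableB _ ig (integrable_classifier c)).
apply: le_Rintegral => //; last exact: integrable_classifier.
apply: (@integrable_norm _ _ _ m setT (fun x => g x - c (kappa x))).
exact: (integrableB _ ig (integrable_classifier c)).
Qed.

End finite_classifier.

(** Weak convergence needs to be tested only on finite measurable partitions:
    it suffices that the masses of the cells converge and that the test
    function is, up to an error of small mean for the limit, constant on
    cells. *)
Lemma cvg_Rintegral_classifier d (T : measurableType d) (R : realType)
    (mu : R -> probability T R) (m : {measure set T -> \bar R}) (g : T -> R) :
  (m setT < +oo)%E -> measurable_fun setT g ->
  (forall eps : R, 0 < eps ->
    exists (I : finType) (kappa : T -> I) (c e : I -> R),
      [/\ forall i, measurable (kappa @^-1` [set i]),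
          forall x, `|g x - c (kappa x)| <= e (kappa x),
          \sum_i e i * fine (m (kappa @^-1` [set i])) <= eps &
          forall i, fine (mu b (kappa @^-1` [set i])) @[b --> +oo] -->
                    fine (m (kappa @^-1` [set i]))]) ->
  \int[mu b]_x g x @[b --> +oo] --> \int[m]_x g x.
Proof.
move=> mfin mg H; apply/cvgrPdist_le => eps eps0.
have [|I [kappa [c [e [mk gce em mu_m]]]]] := H (eps / 4).
  by rewrite divr_gt0.
pose S (w : I -> R) (p : {measure set T -> \bar R}) :=
  \sum_i w i * fine (p (kappa @^-1` [set i])).
have cvgS w : S w (mu b) @[b --> +oo] --> S w m.
  apply: cvg_big => [|i _]; last by apply: cvgMr; exact: mu_m.
  exact: (@add_continuous R).
have near_m : `|\int[m]_x g x - S c m| <= S e m :=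
  Rintegral_near_classifier mk mfin mg gce.
have eps4 : 0 < eps / 4 by rewrite divr_gt0.
near=> b.
have mub : (mu b setT < +oo)%E by rewrite probability_setT ltry.
have near_mu : `|\int[mu b]_x g x - S c (mu b)| <= S e (mu b) :=
  Rintegral_near_classifier mk mub mg gce.
have cb : `|S c m - S c (mu b)| <= eps / 4.
  by near: b; exact: (cvgrPdist_le _ _).1 (cvgS c) _ eps4.
have eb : `|S e m - S e (mu b)| <= eps / 4.
  by near: b; exact: (cvgrPdist_le _ _).1 (cvgS e) _ eps4.
rewrite -/(S e m) in em.
move: near_m near_mu cb eb; rewrite !ler_norml.
by move=> /andP[? ?] /andP[? ?] /andP[? ?] /andP[? ?]; apply/andP; split; lra.
Unshelve. all: by end_near. Qed.

(** * Topology and measurability on the unit interval *)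

Section unit_interval.
Variable R : realType.
Implicit Types (x y : unitI R) (r : R).

Lemma unitI_val_itv x : 0 <= unitI_val x <= 1.
Proof. by have /set_mem := valP x; rewrite /= in_itv. Qed.

Lemma clamp01_subproof r :
  Num.max 0 (Num.min r 1) \in (`[0, 1]%classic : set R).
Proof.
by apply/mem_set; rewrite /= in_itv/= le_max lexx/= ge_max ler01 ge_min lexx orbT.
Qed.

(** The retraction of the real line onto [0,1]; through it a function on [0,1]
    becomes a function on the whole line. *)
Definition clamp01 r : unitI R :=
  exist (fun s : R => s \in (`[0, 1]%classic : set R)) _ (clamp01_subproof r).

Lemma clamp01K r : 0 <= r <= 1 -> unitI_val (clamp01 r) = r.
Proof.
case/andP=> r0 r1; rewrite /unitI_val/= set_valE/=.
by rewrite (min_idPl r1) (max_idPr r0).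
Qed.

Lemma unitI_valK : cancel (@unitI_val R) clamp01.
Proof. by move=> x; apply: unitI_val_inj; rewrite clamp01K// unitI_val_itv. Qed.

Lemma ball_unitIE x e y :
  ball x e y = (`|unitI_val x - unitI_val y| < e) :> Prop.
Proof. by []. Qed.

Lemma continuous_unitI_val : continuous (@unitI_val R).
Proof.
exact: initial_continuous.
Qed.

Lemma continuous_clamp01 : continuous clamp01.
Proof.
have c r : {for r, continuous (fun s : R => Num.max 0 (Num.min s 1))}.
  apply: (@continuous_max _ R); first exact: cst_continuous.
  by apply: (@continuous_min _ R); [exact: id|exact: cst_continuous].
move=> r; apply/cvg_ballP => e e0; near=> s.
rewrite ball_unitIE; near: s.
exact: (cvgrPdist_lt _ _).1 (c r) e e0.
Unshelve. all: by end_near. Qed.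

Lemma unitI_compact : compact [set: unitI R].
Proof.
have -> : [set: unitI R] = clamp01 @` `[0, 1].
  apply/seteqP; split => // x _; exists (unitI_val x); last exact: unitI_valK.
  by rewrite /= in_itv/= unitI_val_itv.
apply: continuous_compact; last exact: segment_compact.
by apply: continuous_subspaceT => ?; exact: continuous_clamp01.
Qed.

Lemma measurable_unitI_val : measurable_fun setT (@unitI_val R).
Proof. by move=> _ Y mY; exists Y => //. Qed.

Lemma measurable_fun_unitI (g : unitI R -> R) :
  measurable_fun setT (g \o clamp01) -> measurable_fun setT g.
Proof.
move=> mg; rewrite (_ : g = (g \o clamp01) \o @unitI_val R).
  exact: measurableT_comp mg measurable_unitI_val.
by apply/funext => x /=; rewrite unitI_valK.
Qed.

Lemma measurable_unitI_continuous (g : unitI R -> R) :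
  continuous g -> measurable_fun setT g.
Proof.
move=> cg; apply: measurable_fun_unitI; apply: continuous_measurable_fun => r.
by apply: continuous_comp; [exact: continuous_clamp01|exact: cg].
Qed.

End unit_interval.

(** Heine-Cantor theorem. *)
Lemma compact_unif_cont (R : realType) (T : pseudoMetricType R) (g : T -> R) :
  compact [set: T] -> continuous g ->
  forall eps, 0 < eps -> exists2 dlt : R, 0 < dlt &
    forall x y, ball x dlt y -> `|g x - g y| <= eps.
Proof.
move=> /compact_near_coveringP cT cg eps eps0.
have eps2 : 0 < eps / 2 by rewrite divr_gt0.
have H0 : forall x : T, setT x -> \forall x' \near x & d \near (0 : R)^'+,
    (fun (d : R) (x' : T) => forall y, ball x' d y -> `|g x' - g y| <= eps) d x'.
  move=> x _.
  have /(cvgrPdist_lt _ _).1 /(_ _ eps2) := cg x.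
  rewrite -nbhs_ballE => -[r /= r0 rg].
  exists (ball x (r / 2), [set d | d < r / 2]) => /=.
    split; first by apply: nbhsx_ballx; rewrite divr_gt0.
    by apply: nbhs_right_lt; rewrite divr_gt0.
  move=> [x' d] /= [xx' dr] y x'y.
  have gx' : `|g x - g x'| < eps / 2.
    by apply: rg; apply: le_ball xx'; rewrite ler_pdivrMr// ler_peMr ?ltW// ltr1n.
  have gy : `|g x - g y| < eps / 2.
    by apply: rg; apply: (ball_split xx'); apply: le_ball x'y; exact: ltW.
  move: gx' gy; rewrite !ltr_norml ler_norml => /andP[? ?] /andP[? ?].
  by apply/andP; split; lra.
have H := cT _ _ _ (at_right_proper_filter 0) H0.
have : \forall d \near (0 : R)^'+, 0 < d /\
    forall x, setT x -> forall y, ball x d y -> `|g x - g y| <= eps.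
  near=> d; split; first by near: d; exact: nbhs_right_gt.
  have dg : setT `<=` (fun x => forall y, ball x d y -> `|g x - g y| <= eps).
    by near: d; exact: H.
  by move=> x _; exact: dg.
move=> /filter_ex[d [d0 dg]]; exists d => // x y; exact: dg.
Unshelve. all: by end_near. Qed.

Lemma compact_bounded_real (R : realType) (T : topologicalType) (g : T -> R) :
  compact [set: T] -> continuous g -> exists M : R, forall x, `|g x| <= M.
Proof.
move=> cT cg.
have /compact_bounded[M [_ gM]] : compact (g @` setT).
  by apply: continuous_compact => //; apply: continuous_subspaceT.
by exists (M + 1) => x; apply: gM => //; rewrite ltrDl.
Qed.

(** * The infinite product of unit intervals *)

Section infinite_product.
Variable R : realType.
Implicit Types x y : Omega R.

Lemma mdist_OmegaE x y : mdist x y = Omega_dist x y.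
Proof. by []. Qed.

(** The coordinates from [n] on contribute at most [2 ^- n] to the distance. *)
Lemma Omega_dist_le x y (n : nat) (dlt : R) : 0 <= dlt ->
  (forall i, (i < n)%N -> `|unitI_val (x i) - unitI_val (y i)| <= dlt) ->
  mdist x y <= dlt + (2 ^+ n)^-1.
Proof.
move=> dlt0 xy.
pose t : R^nat := fun i => `|unitI_val (x i) - unitI_val (y i)| / 2 ^+ i.+1.
have ct : cvgn (series t) by exact: is_cvg_Omega_dist.
rewrite mdist_OmegaE; change (limn (series t) <= dlt + (2 ^+ n)^-1).
have half i : (2 ^+ i.+1)^-1 = (2 ^+ i)^-1 / 2 :> R by rewrite exprSr invfM.
have pos i : 0 <= (2 ^+ i)^-1 :> R by rewrite invr_ge0 exprn_ge0.
have below N : (N <= n)%N -> series t N <= dlt * (1 - (2 ^+ N)^-1).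
  elim: N => [_|N IH Nn].
    by rewrite /series/= big_geq// expr0 invr1 subrr mulr0.
  rewrite seriesSr half.
  have tN : t N <= dlt * ((2 ^+ N)^-1 / 2).
    by rewrite /t half ler_wpM2r ?divr_ge0 ?pos// xy.
  have := IH (ltnW Nn); move: tN; move: (t N) (series t N) => a b.
  rewrite !mulrBr mulrA; lra.
have above k : series t (n + k)%N <= dlt + (2 ^+ n)^-1 - (2 ^+ (n + k))^-1.
  elim: k => [|k IH].
    rewrite addn0 addrK (le_trans (below _ (leqnn n)))//.
    by rewrite ler_piMr// gerBl pos.
  rewrite addnS seriesSr half.
  have tN : t (n + k)%N <= (2 ^+ (n + k))^-1 / 2.
    rewrite /t half ler_piMl ?divr_ge0 ?pos// ler_norml.
    have /andP[? ?] := unitI_val_itv (x (n + k)%N).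
    have /andP[? ?] := unitI_val_itv (y (n + k)%N).
    by apply/andP; split; lra.
  move: tN IH; move: (t _) (series t _) => a b; lra.
apply: limr_le; first exact: ct.
near=> N.
have nN : (n <= N)%N by near: N; exact: nbhs_infty_ge.
by rewrite -(subnKC nN) (le_trans (above _))// gerBl pos.
Unshelve. all: by end_near. Qed.

Lemma exp2_small (e : R) : 0 < e -> exists n, (2 ^+ n)^-1 < e.
Proof.
move=> e0; have /filter_ex[n] := near_infty_natSinv_expn_lt (PosNum e0).
by rewrite /= div1r; exists n.
Qed.

Lemma coord_dist_ball_near (x : prod_topology (fun _ : nat => unitI R))
    (n : nat) (e : R) : 0 < e ->
  \forall y \near x, forall i, (i < n)%N -> `|unitI_val (x i) - unitI_val (y i)| < e.
Proof.
move=> e0; elim: n => [|n IH].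
  by apply: filterS (@filterT _ _ (nbhs_filter x)) => y _ i; rewrite ltn0.
have xn : \forall y \near x, ball (x n) e (y n).
  exact: (@proj_continuous _ (fun=> unitI R) n x _ (nbhsx_ballx _ _ e0)).
apply: (@filterS2 _ _ (nbhs_filter x) _ _ _ _ IH xn) => y yi yn i.
by rewrite ltnS leq_eqVlt => /predU1P[->|/yi//].
Qed.

(** The identity, from the product topology to the metric topology. *)
Definition Omega_of_pointwise (x : prod_topology (fun _ : nat => unitI R)) :
  Omega R := x.

Lemma continuous_Omega_of_pointwise : continuous Omega_of_pointwise.
Proof.
move=> x A; rewrite -nbhs_ballE => -[e /= e0 eA].
have e2 : 0 < e / 2 by rewrite divr_gt0.
have [n ne] := exp2_small e2.
apply: (@filterS _ _ (nbhs_filter x) _ _ _ (coord_dist_ball_near x n e2)).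
move=> y xy; apply: eA; rewrite ballEmdist/=.
rewrite (@le_lt_trans _ _ (e / 2 + (2 ^+ n)^-1))//; last first.
  by rewrite [ltRHS]splitr ltrD2l.
apply: Omega_dist_le; first exact: ltW.
by move=> i /xy/ltW.
Qed.

Lemma Omega_compact : compact [set: Omega R].
Proof.
have -> : [set: Omega R] = Omega_of_pointwise @`
    [set x : prod_topology (fun _ : nat => unitI R) | forall i, setT (x i)].
  by apply/seteqP; split => // x _; exists x.
apply: continuous_compact.
  by apply: continuous_subspaceT => ?; exact: continuous_Omega_of_pointwise.
by apply: (@tychonoff _ (fun=> unitI R) (fun=> setT)) => _; exact: unitI_compact.
Qed.

Lemma measurable_coord (i : nat) : measurable_fun setT (fun x : Omega R => x i).
Proof.
move=> _ Y mY; apply: sub_sigma_algebra.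
by exists i => //; exists Y.
Qed.

Section words.
Variables (I : finType) (kappa : unitI R -> I).
Hypothesis mkappa : forall i, measurable (kappa @^-1` [set i]).

(** The classes of the first [n + 1] coordinates of a point of the product. *)
Definition word n x : {ffun 'I_n.+1 -> I} := [ffun i : 'I_n.+1 => kappa (x i)].

Lemma word_fiber n (w : {ffun 'I_n.+1 -> I}) :
  word n @^-1` [set w] =
  [set x | forall i, (i < n.+1)%N -> (kappa @^-1` [set w (inord i)]) (x i)].
Proof.
apply/seteqP; split => [x /= <- i ni|x /= xw].
  by rewrite ffunE inordK.
by apply/ffunP => i; rewrite ffunE xw// inord_val.
Qed.

Lemma measurable_word n (w : {ffun 'I_n.+1 -> I}) :
  measurable (word n @^-1` [set w]).
Proof.
rewrite word_fiber (_ : [set x | _] = \bigcap_(i in `I_n.+1)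
  ((fun x : Omega R => x i) @^-1` (kappa @^-1` [set w (inord i)]))).
  apply: fin_bigcap_measurable => // i _; rewrite -[X in measurable X]setTI.
  exact: measurable_coord.
by apply/seteqP; split.
Qed.

End words.

(** A continuous function is the pointwise limit of its values at the points
    obtained by rounding the first coordinates to multiples of [1 / (n + 1)],
    and each of these approximations only depends on a word. *)
Lemma measurable_Omega_continuous (g : Omega R -> R) :
  continuous g -> measurable_fun setT g.
Proof.
move=> cg.
pose kappa (n : nat) (a : unitI R) : 'I_n.+2 :=
  inord (Num.truncn (n.+1%:R * unitI_val a)).
(* The coordinates of index larger than [n] are given a value depending on
   [w] only, whatever it is: they are negligible in the limit. *)
pose c n (w : {ffun 'I_n.+1 -> 'I_n.+2}) : Omega R :=
  fun i => clamp01 ((w (inord i))%:R / n.+1%:R).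
pose p n x := c n (word (kappa n) n x).
have n1_gt0 n : 0 < n.+1%:R :> R by rewrite ltr0n.
have scaled_ge0 n (a : unitI R) : 0 <= n.+1%:R * unitI_val a.
  by rewrite mulr_ge0//; have /andP[] := unitI_val_itv a.
have kappaE n a : kappa n a = Num.truncn (n.+1%:R * unitI_val a) :> nat.
  rewrite inordK// ltnS truncn_le_nat (@le_lt_trans _ _ n.+1%:R) ?ltr_nat//.
  by rewrite ler_piMr//; have /andP[] := unitI_val_itv a.
have mp n : measurable_fun setT (g \o p n).
  apply: (@measurable_fun_classifier _ _ R _ (word (kappa n) n) _ (g \o c n)).
  move=> w; apply: measurable_word => i.
  rewrite (_ : _ @^-1` _ =
    @unitI_val R @^-1` `[i%:R / n.+1%:R, i.+1%:R / n.+1%:R[).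
    by rewrite -[X in measurable X]setTI; exact: measurable_unitI_val.
  apply/seteqP; split => a /=; rewrite in_itv/= ler_pdivrMr// ltr_pdivlMr//;
    rewrite [unitI_val a * _]mulrC -(truncn_eq _ (scaled_ge0 n a)) -kappaE.
    by move=> ->.
  by move=> /eqP ai; exact: ord_inj.
apply: (@measurable_fun_cvg _ _ _ _ (fun n => g \o p n)) => // x _.
apply: (cvg_comp (p ^~ x) g); last exact: cg.
apply/cvg_ballP => e e0.
have e2 : 0 < e / 2 by rewrite divr_gt0.
near=> n; rewrite ballEmdist/=.
rewrite (@le_lt_trans _ _ (n.+1%:R^-1 + (2 ^+ n)^-1))//.
  apply: Omega_dist_le; first by rewrite invr_ge0.
  move=> i ni; rewrite /p /c ffunE inordK ?kappaE; last exact: ltnW.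
  set a := x i.
  have /andP[lo hi] := truncn_itv (scaled_ge0 n a).
  have /andP[a0 a1] := unitI_val_itv a.
  move: lo hi; set k := Num.truncn _; rewrite mulrC -ler_pdivrMr// -ltr_pdivlMr//.
  rewrite -[k.+1%:R]natr1 mulrDl mul1r => lo hi.
  rewrite clamp01K; last by rewrite divr_ge0//= (le_trans lo).
  by rewrite ger0_norm ?subr_ge0// lerBlDl ltW.
rewrite [e]splitr ltrD//; near: n.
  exact: near_infty_natSinv_lt (PosNum e2).
by under eq_near do rewrite -div1r; exact: near_infty_natSinv_expn_lt (PosNum e2).
Unshelve. all: by end_near. Qed.

End infinite_product.

(** * From fine partitions to weak convergence *)

(** The weak convergence criterion in the form used below: on each cell the
    test function oscillates little, or the cell is null for the limit. *)
Lemma cvg_Rintegral_oscillation d (T : measurableType d) (R : realType)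
    (mu : R -> probability T R) (m : {measure set T -> \bar R}) (g : T -> R)
    (M : R) :
  m setT = 1%E -> measurable_fun setT g -> (forall x, `|g x| <= M) ->
  (forall eps : R, 0 < eps -> exists (I : finType) (kappa : T -> I),
    [/\ forall i, measurable (kappa @^-1` [set i]),
        forall i, fine (mu b (kappa @^-1` [set i])) @[b --> +oo] -->
                  fine (m (kappa @^-1` [set i])) &
        forall i, fine (m (kappa @^-1` [set i])) = 0 \/
          forall x y, kappa x = i -> kappa y = i -> `|g x - g y| <= eps]) ->
  \int[mu b]_x g x @[b --> +oo] --> \int[m]_x g x.
Proof.
move=> m1 mg gM H; have mfin : (m setT < +oo)%E by rewrite m1 ltry.
apply: cvg_Rintegral_classifier => // eps eps0.
have [I [kappa [mk mu_m small]]] := H eps eps0.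
pose ok i (ce : R * R) := (forall x, kappa x = i -> `|g x - ce.1| <= ce.2) /\
  ce.2 * fine (m (kappa @^-1` [set i])) <= eps * fine (m (kappa @^-1` [set i])).
have /choice[ce ceP] : forall i, exists ce, ok i ce.
  move=> i; have [m0|osc] := small i.
    by exists (0, M); split; [move=> x _; rewrite subr0|rewrite m0 !mulr0].
  have [[x0 x0i]|noi] := pselect (exists x, kappa x = i).
    by exists (g x0, eps); split => //= x xi; exact: osc.
  by exists (0, eps); split => // x xi; exfalso; apply: noi; exists x.
exists I, kappa, (fun i => (ce i).1), (fun i => (ce i).2); split => //.
  by move=> x; have [+ _] := ceP (kappa x); exact.
apply: (@le_trans _ _ (\sum_i eps * fine (m (kappa @^-1` [set i])))).
  by apply: ler_sum => i _; have [] := ceP i.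
by rewrite -(Rintegral_classifier mk mfin (fun=> eps)) Rintegral_cst// m1 mulr1.
Qed.

Section weak_convergence.
Variable R : realType.
Variables (mu0 : R -> probability (unitI R) R)
  (nu : {measure set (unitI R) -> \bar R}).
Hypothesis nu1 : nu setT = 1%E.

(** The masses given by [mu0 b] converge to those given by [nu] on finite
    partitions of [0,1] whose cells are [nu]-null or arbitrarily small. *)
Definition cvg_on_fine_partitions :=
  forall dlt : R, 0 < dlt -> exists (I : finType) (kappa : unitI R -> I),
    [/\ forall i, measurable (kappa @^-1` [set i]),
        forall i, fine (mu0 b (kappa @^-1` [set i])) @[b --> +oo] -->
                  fine (nu (kappa @^-1` [set i])) &
        forall i, fine (nu (kappa @^-1` [set i])) = 0 \/
          forall x y, kappa x = i -> kappa y = i ->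
                      `|unitI_val x - unitI_val y| < dlt].

Hypothesis mu0_nu : cvg_on_fine_partitions.

Lemma weak_star_cvg_unitI : weak_star_cvg mu0 nu.
Proof.
move=> g cg; have [M gM] := compact_bounded_real (@unitI_compact R) cg.
apply: cvg_Rintegral_oscillation gM _ => //.
  exact: measurable_unitI_continuous.
move=> eps eps0.
have [dlt dlt0 gdlt] := compact_unif_cont (@unitI_compact R) cg eps0.
have [I [kappa [mk cvgk small]]] := mu0_nu dlt0.
exists I, kappa; split => // i; have [->|sm] := small i; [by left|right].
by move=> x y xi yi; apply: gdlt; rewrite ball_unitIE; exact: sm.
Qed.

Variables (mu : R -> probability (Omega R) R)
  (mu_infty : probability (Omega R) R).
Hypothesis mu_product : forall b : R, 0 < b -> is_product_power (mu0 b) (mu b).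
Hypothesis mu_infty_product : is_product_power nu mu_infty.

Lemma product_power_word (p : {measure set (unitI R) -> \bar R})
    (P : probability (Omega R) R) (I : finType) (kappa : unitI R -> I) n
    (w : {ffun 'I_n.+1 -> I}) :
  p setT = 1%E -> (forall i, measurable (kappa @^-1` [set i])) ->
  is_product_power p P ->
  fine (P (word kappa n @^-1` [set w])) =
  \prod_(i < n.+1) fine (p (kappa @^-1` [set w i])).
Proof.
move=> p1 mk pP.
rewrite word_fiber (pP n.+1 (fun i => kappa @^-1` [set w (inord i)]))//.
rewrite (eq_bigr (fun i : 'I_n.+1 => (fine (p (kappa @^-1` [set w i])))%:E)).
  by rewrite prodEFin.
move=> i _; rewrite inord_val fineK// ge0_fin_numE//.
rewrite (@le_lt_trans _ _ 1%E) ?ltry// -p1.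
by apply: le_measure => //; rewrite inE.
Qed.

Lemma weak_star_cvg_Omega : weak_star_cvg mu mu_infty.
Proof.
move=> g cg; have [M gM] := compact_bounded_real (@Omega_compact R) cg.
apply: cvg_Rintegral_oscillation gM _ => //.
- exact: probability_setT.
- exact: measurable_Omega_continuous.
move=> eps eps0.
have [dlt dlt0 gdlt] := compact_unif_cont (@Omega_compact R) cg eps0.
have dlt2 : 0 < dlt / 2 by rewrite divr_gt0.
have [n nd] := exp2_small dlt2.
have [I [kappa [mk cvgk small]]] := mu0_nu dlt2.
exists {ffun 'I_n.+1 -> I}, (word kappa n); split.
- by move=> w; exact: measurable_word.
- move=> w; rewrite (product_power_word w nu1 mk mu_infty_product).
  apply: (@cvg_trans _ ((\prod_(i < n.+1) fine (mu0 b (kappa @^-1` [set w i])))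
    @[b --> +oo])).
    apply: near_eq_cvg; near=> b.
    rewrite (product_power_word w _ mk (mu_product _))//.
    exact: probability_setT.
  apply: cvg_big => [|i _]; last exact: cvgk.
  exact: (@mul_continuous R).
move=> w; rewrite (product_power_word w nu1 mk mu_infty_product).
have [[i wi0]|nonnull] := pselect (exists i, fine (nu (kappa @^-1` [set w i])) = 0).
  by left; rewrite (bigD1 i)//= wi0 mul0r.
right => x y xw yw; apply: gdlt; rewrite ballEmdist/=.
rewrite (@le_lt_trans _ _ (dlt / 2 + (2 ^+ n)^-1))//.
  apply: Omega_dist_le; first exact: ltW.
  move=> i ni; apply: ltW.
  have [wi0|sm] := small (w (inord i)).
    by exfalso; apply: nonnull; exists (inord i).
  by apply: sm; [rewrite -xw|rewrite -yw]; rewrite ffunE inordK// ltnW.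
by rewrite [ltRHS]splitr ltrD2l.
Unshelve. all: by end_near. Qed.

End weak_convergence.

(** * Second derivative comparison at critical points *)

Section calculus.
Variable R : realType.

Lemma is_derive_clamp01 (F F' : unitI R -> R) (r : R) :
  is_derivative01 F F' -> 0 < r < 1 ->
  is_derive r 1 (F \o @clamp01 R) (F' (clamp01 r)).
Proof.
move=> dF /andP[r0 r1].
have rK : unitI_val (clamp01 r) = r by rewrite clamp01K// !ltW.
have small : \forall h \near (0 : R)^', 0 <= h + r <= 1.
  near=> h; have : `|h| < Num.min r (1 - r).
    near: h; apply: dnbhs0_lt; rewrite lt_min r0/=; lra.
  rewrite lt_min !ltr_norml => /andP[/andP[? ?] /andP[? ?]].
  by apply/andP; split; lra.
have cvgl : h^-1 *: ((F \o @clamp01 R) (h *: 1 + r) - (F \o @clamp01 R) r)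
    @[h --> (0 : R)^'] --> F' (clamp01 r).
  have lim : clamp01 (h + r) @[h --> (0 : R)^'] --> (clamp01 r)^'.
    move=> A clA; change (\forall h \near (0 : R)^', A (clamp01 (h + r))).
    have {}clA : nbhs (clamp01 r) [set y | y != clamp01 r -> A y] := clA.
    have shiftr : h + r @[h --> (0 : R)] --> r.
      rewrite -[X in _ --> X]add0r; apply: cvgD; [exact: cvg_id|exact: cvg_cst].
    have := shiftr _ (@continuous_clamp01 R r _ clA); rewrite /= => H.
    near=> h; have : clamp01 (h + r) != clamp01 r -> A (clamp01 (h + r)).
      by near: h; exact: nbhs_dnbhs H.
    apply; apply/eqP => /(congr1 (@unitI_val R)).
    rewrite rK clamp01K; last by near: h.
    move/eqP; rewrite -subr_eq0 addrK => /eqP h0.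
    have : h != 0 by near: h; exact: nbhs_dnbhs_neq.
    by rewrite h0 eqxx.
  apply: cvg_trans (cvg_comp _ _ lim (dF (clamp01 r))).
  apply: near_eq_cvg; near=> h.
  rewrite /= /GRing.scale/= mulr1 rK clamp01K; last by near: h.
  by rewrite addrK mulrC.
apply: DeriveDef; first exact: cvgP cvgl.
exact: (cvg_lim _ cvgl).
Unshelve. all: by end_near. Qed.

(** Second derivative test. The derivative of [phi] needs to be differentiable
    at [0] only. *)
Lemma local_min_of_derive2_gt0 (phi dphi : R -> R) (l : R) :
  (\forall t \near (0 : R), is_derive (t : R) (1 : R) phi (dphi t)) ->
  dphi 0 = 0 -> is_derive (0 : R) 1 dphi l -> 0 < l ->
  \forall t \near (0 : R), phi 0 <= phi t.
Proof.
move=> dphiP d0 ddphi l0.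
have lim : h^-1 *: (dphi (h *: 1 + 0) - dphi 0) @[h --> (0 : R)^'] --> l.
  rewrite -(@derive_val _ _ _ _ _ _ _ ddphi).
  exact: (@ex_derive _ _ _ _ _ _ _ ddphi).
have sgn : \forall h \near (0 : R), h != 0 -> 0 < h^-1 * dphi h.
  have /(cvgr_gt _) /(_ _ l0) := lim.
  rewrite near_withinE; apply: filterS => h /[apply].
  by rewrite d0 subr0 addr0 /GRing.scale/= mulr1.
have := @filterI _ _ (nbhs_filter (0 : R)) _ _ dphiP sgn.
rewrite -nbhs_ballE => -[e /= e0 eP].
change (nbhs (0 : R) [set t | phi 0 <= phi t]).
rewrite -nbhs_ballE; exists e => //= t; rewrite /ball/= sub0r normrN => te.
have inball (s : R) : `|s| <= `|t| -> is_derive s (1 : R) phi (dphi s) /\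
    (s != 0 -> 0 < s^-1 * dphi s).
  by move=> st; apply: eP; rewrite /ball/= sub0r normrN (le_lt_trans st).
have cphi (s : R) : `|s| <= `|t| -> {for s, continuous phi}.
  move=> /inball[ds _]; apply: differentiable_continuous.
  by apply/derivable1_diffP; exact: ex_derive.
have [->//|/lt_total/orP[t0|t0]] := eqVneq t 0.
- have bnd s : s \in `[t, 0]%R -> `|s| <= `|t|.
    by rewrite in_itv/= => /andP[ts s0]; rewrite !ler0_norm ?lerN2// ltW.
  have [] := @MVT R phi dphi t 0 t0.
  + by move=> s /subset_itv_oo_cc/bnd/inball[].
  + by apply: continuous_in_subspaceT => s; rewrite inE => /bnd/cphi.
  move=> s sI E; rewrite -subr_le0 E sub0r.
  have s0 : s < 0 by move: sI; rewrite in_itv/= => /andP[].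
  have [_ /(_ (ltr0_neq0 s0))] := inball s (bnd s (subset_itv_oo_cc sI)).
  rewrite nmulr_rgt0 ?invr_lt0// => ds0.
  by rewrite nmulr_rle0 ?oppr_ge0 ?ltW.
- have bnd s : s \in `[0, t]%R -> `|s| <= `|t|.
    by rewrite in_itv/= => /andP[s0 st]; rewrite !ger0_norm// ltW.
  have [] := @MVT R phi dphi 0 t t0.
  + by move=> s /subset_itv_oo_cc/bnd/inball[].
  + by apply: continuous_in_subspaceT => s; rewrite inE => /bnd/cphi.
  move=> s sI E; rewrite -subr_ge0 E subr0.
  have s0 : 0 < s by move: sI; rewrite in_itv/= => /andP[].
  have [_ /(_ (lt0r_neq0 s0))] := inball s (bnd s (subset_itv_oo_cc sI)).
  rewrite pmulr_rgt0 ?invr_gt0// => ds0.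
  by rewrite mulr_ge0 ?ltW.
Qed.

(** [G1] and [G2] are the first two derivatives of [G] inside [0,1]. *)
Variables (G G1 G2 : R -> R).
Hypothesis dG : forall r : R, 0 < r < 1 -> is_derive r 1 G (G1 r).
Hypothesis dG1 : forall r : R, 0 < r < 1 -> is_derive r 1 G1 (G2 r).

Lemma derive1_at_interior_max (a : R) : 0 < a < 1 ->
  (forall r : R, 0 < r < 1 -> G r <= G a) -> G1 a = 0.
Proof.
move=> a01 maxa.
have H : is_derive a 1 G 0.
  apply: (@derive1_at_max _ G 0 1 a ler01).
  - by move=> t; rewrite in_itv/= => /dG d; exact: ex_derive.
  - by rewrite in_itv.
  - by move=> t; rewrite in_itv/=; exact: maxa.
by rewrite -(@derive_val _ _ _ _ _ _ _ (dG a01)) (@derive_val _ _ _ _ _ _ _ H).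
Qed.

Lemma near_interior (a k : R) : 0 < a < 1 ->
  \forall t \near (0 : R), 0 < a + k * t < 1.
Proof.
move=> /andP[a0 a1].
have c : a + k * t @[t --> (0 : R)] --> a.
  rewrite -[X in _ --> X]addr0 -[X in _ + X](mulr0 k).
  by apply: cvgD; [exact: cvg_cst|apply: cvgMr; exact: cvg_id].
near=> t; apply/andP; split; near: t.
  exact: (cvgr_gt _ c).
exact: (cvgr_lt _ c).
Unshelve. all: by end_near. Qed.

Lemma is_derive_affine (f df : R -> R) (a k t : R) :
  is_derive (a + k * t) 1 f (df (a + k * t)) ->
  is_derive t 1 (fun t => f (a + k * t)) (k * df (a + k * t)).
Proof.
move=> d.
have l : is_derive t 1 (fun t : R => a + k * t) k.
  by apply: is_derive_eq; rewrite /GRing.scale/= add0r mul1r mulr1.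
have := @is_derive1_comp R f (fun t : R => a + k * t) t _ _ d l.
by rewrite mulrC.
Qed.

(** Near two critical points at the same height, the graph around [a'],
    rescaled by [k], lies below the graph around [a]: the difference has a
    critical point at [0] with second derivative [G2 a - k ^+ 2 * G2 a']. *)
Lemma compare_near_critical (a a' k : R) : 0 < a < 1 -> 0 < a' < 1 ->
  G a = G a' -> G1 a = 0 -> G1 a' = 0 -> k ^+ 2 * G2 a' < G2 a ->
  \forall t \near (0 : R), G (a' + k * t) <= G (a + t).
Proof.
move=> a01 a'01 Gaa' G1a G1a' kG2.
pose phi t := G (a + 1 * t) - G (a' + k * t).
pose dphi t := 1 * G1 (a + 1 * t) - k * G1 (a' + k * t).
have : \forall t \near (0 : R), phi 0 <= phi t.
  apply: (@local_min_of_derive2_gt0 phi dphi (1 * (1 * G2 (a + 1 * 0)) -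
    k * (k * G2 (a' + k * 0)))).
  - have n1 := near_interior 1 a01; have n2 := near_interior k a'01.
    near=> t; apply: is_deriveB; apply: is_derive_affine; apply: dG; near: t.
      exact: n1.
    exact: n2.
  - by rewrite /dphi !mulr0 !addr0 G1a G1a' !mulr0 subrr.
  - apply: is_deriveB; apply: is_deriveZ; apply: is_derive_affine; apply: dG1;
      by rewrite mulr0 addr0.
  - by rewrite !mulr0 !addr0 !mul1r subr_gt0 mulrA -expr2.
apply: filterS => t; rewrite /phi !mulr0 !addr0 Gaa' subrr mul1r.
by rewrite subr_ge0.
Unshelve. all: by end_near. Qed.

(** The strictness assumption is needed because the second derivative test only
    yields a weak inequality. *)
Lemma derive2_at_interior_max (a : R) : 0 < a < 1 ->
  (forall r : R, 0 < r < 1 -> G r <= G a) ->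
  (forall e : R, 0 < e -> exists t, `|t| < e /\ G (a + t) < G a) ->
  G2 a <= 0.
Proof.
move=> a01 maxa strict; rewrite leNgt; apply/negP => G2a.
have G1a := derive1_at_interior_max a01 maxa.
(* Comparing [a] with itself for [k = 0] says that [a] is a local minimum. *)
have kG2 : 0 ^+ 2 * G2 a < G2 a by rewrite expr0n/= mul0r.
have : nbhs (0 : R) [set t | G (a + 0 * t) <= G (a + t)].
  exact: (compare_near_critical a01 a01 erefl G1a G1a kG2).
rewrite -nbhs_ballE => -[e /= e0 eP].
have [t [te]] := strict e e0; rewrite ltNge => /negP; apply.
have := eP t; rewrite /ball/= sub0r normrN mul0r addr0; exact.
Qed.

End calculus.

(** * Mass bounds for Gibbs densities *)

Section gibbs.
Variable R : realType.

Lemma pushforward_lebesgue01 (A : set R) : measurable A -> A `<=` `[0, 1] ->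
  pushforward (lebesgue01 (R:=R)) (@unitI_val R) A = lebesgue_measure A.
Proof.
move=> mA A01; rewrite /pushforward; congr lebesgue_measure.
apply/seteqP; split => [_ [x Ax <-]//|r Ar].
have r01 : 0 <= r <= 1 by have := A01 r Ar; rewrite /= in_itv.
by exists (clamp01 r); rewrite /= clamp01K.
Qed.

Lemma ge0_integral_lebesgue01 (D : set R) (H : R -> \bar R) :
  measurable D -> D `<=` `[0, 1] -> measurable_fun D H ->
  (forall r, D r -> 0 <= H r)%E ->
  (\int[lebesgue01 (R:=R)]_(a in @unitI_val R @^-1` D) H (unitI_val a) =
   \int[lebesgue_measure]_(r in D) H r)%E.
Proof.
move=> mD D01 mH H0.
pose phi : unitI R -> measurableTypeR R := @unitI_val R.
have mphi : measurable_fun setT phi := measurable_unitI_val (R:=R).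
pose nu := (pushforward (lebesgue01 (R:=R)) phi :
  {measure set (measurableTypeR R) -> \bar R}).
rewrite -[LHS](@ge0_integral_pushforward _ _ _ _ _ _ mphi (lebesgue01 (R:=R)) D H)//;
  last by move=> r; rewrite inE; exact: H0.
have E := @eq_measure_integral _ (measurableTypeR R) R D lebesgue_measure
  (nu mphi) H.
refine (E _) => A mA AD.
by apply: pushforward_lebesgue01 => // r /AD/D01.
Qed.

(** [Z] is only required to be nonnegative: that it normalizes the density
    follows from [p] being a probability. *)
Variables (F : unitI R -> R) (p : probability (unitI R) R) (beta Z : R).
Hypothesis cF : continuous F.
Hypothesis beta0 : 0 <= beta.
Hypothesis Z0 : 0 <= Z.
Hypothesis pF : has_density p (fun a => expR (beta * F a) / Z).

Let mden : measurable_fun setT (fun a => (expR (beta * F a) / Z)%:E).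
Proof.
apply/measurable_EFinP; apply: measurable_funM => //.
apply: measurableT_comp => //; apply: measurable_funM => //.
exact: measurable_unitI_continuous.
Qed.

Let den0 a : 0 <= expR (beta * F a) / Z.
Proof. by rewrite divr_ge0// expR_ge0. Qed.

(** The mass of [V] is at most [1], which bounds [1 / Z] from above. *)
Lemma gibbs_mass_le (A V : set (unitI R)) (m1 m2 : R) :
  measurable A -> measurable V ->
  (forall a, A a -> F a <= m1) -> (forall a, V a -> m2 <= F a) ->
  fine (p A) * fine (lebesgue01 V) <= expR (beta * (m1 - m2)).
Proof.
move=> mA mV Am1 Vm2.
have pA : (p A <= (expR (beta * m1) / Z)%:E)%E.
  rewrite pF//; apply: (@le_trans _ _
    (\int[lebesgue01 (R:=R)]_(a in A) (expR (beta * m1) / Z)%:E)%E).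
    apply: ge0_le_integral => //.
    - by move=> a Aa; rewrite lee_fin.
    - exact: measurable_funTS.
    - by move=> a Aa; rewrite lee_fin ler_wpM2r ?invr_ge0// ler_expR ler_wpM2l// Am1.
  rewrite integral_cst// -[leRHS]mule1 lee_wpmul2l//.
    by rewrite lee_fin divr_ge0// expR_ge0.
  exact: (@probability_le1 _ _ _ (lebesgue01 (R:=R))).
have pV : ((expR (beta * m2) / Z)%:E * lebesgue01 V <= p V)%E.
  rewrite pF// -integral_cst//.
  apply: ge0_le_integral => //.
  - by move=> a Va; rewrite lee_fin divr_ge0// expR_ge0.
  - exact: measurable_funTS.
  - by move=> a Va; rewrite lee_fin ler_wpM2r ?invr_ge0// ler_expR ler_wpM2l// Vm2.
have v_fin : lebesgue01 V \is a fin_num by exact: fin_num_measure.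
have p_fin U : measurable U -> p U \is a fin_num.
  by move=> mU; exact: fin_num_measure.
have pV1 : expR (beta * m2) / Z * fine (lebesgue01 V) <= 1.
  rewrite -lee_fin EFinM fineK//; apply: le_trans pV _.
  exact: probability_le1.
have {}pA : fine (p A) <= expR (beta * m1) / Z by rewrite -lee_fin fineK// p_fin.
apply: le_trans (ler_wpM2r (fine_ge0 (measure_ge0 _ _)) pA) _.
have -> : beta * m1 = beta * (m1 - m2) + beta * m2 by rewrite -mulrDr subrK.
rewrite expRD -!mulrA ler_piMr ?expR_ge0// mulrA.
exact: pV1.
Qed.

Let cG : continuous (fun r : R => expR (beta * F (clamp01 r)) / Z).
Proof.
move=> r; apply: cvgMl; apply: continuous_cvg; first exact: continuous_expR.
apply: cvgMr; apply: (@continuous_comp _ _ _ (@clamp01 R) F).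
  exact: continuous_clamp01.
exact: cF.
Qed.

Lemma gibbs_mass_itv (lo hi : R) : 0 <= lo -> hi <= 1 ->
  p (@unitI_val R @^-1` `[lo, hi]) =
  (\int[lebesgue_measure]_(r in `[lo, hi])
     (expR (beta * F (clamp01 r)) / Z)%:E)%E.
Proof.
move=> lo0 hi1; rewrite pF; last first.
  by rewrite -[X in measurable X]setTI; exact: measurable_unitI_val.
rewrite -(@ge0_integral_lebesgue01 _
  (fun r => (expR (beta * F (clamp01 r)) / Z)%:E)).
- by apply: eq_integral => a _; rewrite unitI_valK.
- exact: measurable_itv.
- move=> r; rewrite /= !in_itv/= => /andP[lr rh].
  by rewrite (le_trans lo0 lr) (le_trans rh).
- apply: measurable_funTS; apply/measurable_EFinP.
  exact: continuous_measurable_fun cG.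
- by move=> r _; rewrite lee_fin.
Qed.

Lemma gibbs_mass_scaled (a a' k dlt : R) : 0 < k -> 0 < dlt ->
  0 <= a - dlt -> a + dlt <= 1 -> 0 <= a' - k * dlt -> a' + k * dlt <= 1 ->
  (forall t, `|t| <= dlt -> F (clamp01 (a' + k * t)) <= F (clamp01 (a + t))) ->
  fine (p (@unitI_val R @^-1` `[a' - k * dlt, a' + k * dlt])) <=
  k * fine (p (@unitI_val R @^-1` `[a - dlt, a + dlt])).
Proof.
move=> k0 dlt0 a0 a1 a'0 a'1 Fle.
pose den (r : R) := expR (beta * F (clamp01 r)) / Z.
(* The affine bijection from the interval around [a] to the one around [a']. *)
pose f (r : R) := a' + k * (r - a).
have flo : f (a - dlt) = a' - k * dlt by rewrite /f addrAC subrr add0r mulrN.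
have fhi : f (a + dlt) = a' + k * dlt by rewrite /f addrAC subrr add0r.
have df (r : R) : is_derive r 1 f k.
  by rewrite /f; apply: is_derive_eq; rewrite /GRing.scale/= add0r mul1r subr0 mulr1.
have f1 : derive1 f = fun=> k.
  by apply/funext => r; rewrite derive1E; exact: (@derive_val _ _ _ _ _ _ _ (df r)).
have cf : continuous f.
  move=> r; apply: differentiable_continuous; apply/derivable1_diffP.
  exact: ex_derive.
have sub : (\int[lebesgue_measure]_(r in `[(a' - k * dlt)%R, (a' + k * dlt)%R])
      (den r)%:E =
    \int[lebesgue_measure]_(r in `[(a - dlt)%R, (a + dlt)%R])
      (den (f r) * k)%:E)%E.
  rewrite -flo -fhi (@integration_by_substitution_increasing R f den).
  - by apply: eq_integral => r _; rewrite f1.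
  - lra.
  - by move=> x y _ _; rewrite /f ltrD2l ltr_pM2l// ltrD2r.
  - by move=> r _; rewrite f1; exact: cst_continuous.
  - by rewrite f1; exact: is_cvg_cst.
  - by rewrite f1; exact: is_cvg_cst.
  - split; first by move=> r _; exact: ex_derive.
      by apply: cvg_at_right_filter; exact: cf.
    by apply: cvg_at_left_filter; exact: cf.
  - by apply: continuous_subspaceT => r; exact: cG.
have mU (lo hi : R) : measurable (@unitI_val R @^-1` `[lo, hi]).
  by rewrite -[X in measurable X]setTI; exact: measurable_unitI_val.
suff : (p (@unitI_val R @^-1` `[(a' - k * dlt)%R, (a' + k * dlt)%R]) <=
    k%:E * p (@unitI_val R @^-1` `[(a - dlt)%R, (a + dlt)%R]))%E.
  rewrite -[in leLHS](fineK (fin_num_measure p _ (mU _ _))).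
  rewrite -[in leRHS](fineK (fin_num_measure p _ (mU _ _))).
  by rewrite -EFinM lee_fin.
have mden' : measurable_fun `[a - dlt, a + dlt] (EFin \o den).
  apply: measurable_funTS; apply/measurable_EFinP.
  exact: continuous_measurable_fun cG.
rewrite !gibbs_mass_itv// sub -ge0_integralZl//; last exact: ltW.
apply: ge0_le_integral => //.
- by move=> r _; rewrite lee_fin; apply: mulr_ge0; [exact: den0|exact: ltW].
- apply: measurable_funTS; apply/measurable_EFinP; apply: measurable_funM => //.
  apply: continuous_measurable_fun => r.
  by apply: (@continuous_comp _ _ _ f den); [exact: cf|exact: cG].
- exact: measurable_funeM.
- move=> r; rewrite /= in_itv/= => /andP[lr rh].
  rewrite -EFinM lee_fin mulrC ler_pM2l// ler_wpM2r ?invr_ge0// ler_expR ler_wpM2l//.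
  have := Fle (r - a); rewrite [a + (r - a)]addrC subrK; apply.
  by rewrite ler_norml; apply/andP; split; lra.
by move=> r _; rewrite lee_fin; exact: den0.
Qed.

End gibbs.

(** * Concentration near the maximizers *)

Section concentration.
Variable R : realType.
Variables (F : unitI R -> R) (mu0 : R -> probability (unitI R) R) (Z : R -> R).
Hypothesis cF : continuous F.
Hypothesis Z0 : forall b, 0 <= Z b.
Hypothesis mu0F : forall b : R, 0 < b ->
  has_density (mu0 b) (fun a => expR (b * F a) / Z b).

(** The points of [0,1] at distance less than [r] from [a]. *)
Definition near_point (a : unitI R) (r : R) : set (unitI R) :=
  [set x | `|unitI_val x - unitI_val a| < r].

(** The points of [0,1] at distance at least [r] from [a]. *)
Definition away_from (a : unitI R) (r : R) : set (unitI R) :=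
  [set x | r <= `|unitI_val x - unitI_val a|].

Lemma near_pointC a r : ~` near_point a r = away_from a r.
Proof.
by apply/seteqP; split => x /=; rewrite /away_from/= leNgt => /negP.
Qed.

Lemma closed_away_from a r : closed (away_from a r).
Proof.
pose h (x : unitI R) := `|unitI_val x - unitI_val a|.
have ch : continuous h.
  move=> x; apply: (@continuous_comp _ _ _ (fun y => unitI_val y - unitI_val a)
    (@Num.norm R R)); last exact: norm_continuous.
  apply: (@continuousB _ _ _ (@unitI_val R) (fun=> unitI_val a)).
    exact: continuous_unitI_val.
  exact: cst_continuous.
apply: (@preimage_closed _ _ h [set s | r <= s]); last exact: closed_ge.
by move=> x _; exact: ch.
Qed.

Lemma measurable_near_point a r : measurable (near_point a r).
Proof.
rewrite (_ : near_point a r =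
  @unitI_val R @^-1` `]unitI_val a - r, unitI_val a + r[).
  by rewrite -[X in measurable X]setTI; exact: measurable_unitI_val.
apply/seteqP; split => x /=; rewrite /near_point/= in_itv/= ltr_norml.
  by move=> /andP[? ?]; apply/andP; split; lra.
by move=> /andP[? ?]; apply/andP; split; lra.
Qed.

Lemma measurable_away_from a r : measurable (away_from a r).
Proof.
by rewrite -near_pointC; apply: measurableC; exact: measurable_near_point.
Qed.

Lemma lebesgue01_itv (lo hi : R) : 0 <= lo -> lo <= hi -> hi <= 1 ->
  fine (lebesgue01 (@unitI_val R @^-1` `[lo, hi])) = hi - lo.
Proof.
move=> lo0 lohi hi1.
have := @pushforward_lebesgue01 R `[lo, hi] (measurable_itv _).
rewrite /pushforward => ->.
  rewrite lebesgue_measure_itv/= lte_fin.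
  by move: lohi; rewrite le_eqVlt => /predU1P[->|->//]; rewrite ltxx subrr.
move=> r; rewrite /= !in_itv/= => /andP[lr rh].
by rewrite (le_trans lo0)// (le_trans rh).
Qed.

(** The mass of [C] is compared with that of an interval around [a] on which
    [F] is larger than on [C] by a fixed amount. *)
Lemma gibbs_mass_vanishes (C : set (unitI R)) (a : unitI R) (eps : R) :
  closed C -> measurable C -> 0 < unitI_val a < 1 ->
  (forall x, C x -> F x < F a) -> 0 < eps ->
  \forall b \near +oo, fine (mu0 b C) <= eps.
Proof.
move=> clC mC a01 CF eps0.
have [m1 m1a Cm1] : exists2 m1, m1 < F a & forall x, C x -> F x <= m1.
  have [[x0 Cx0]|noC] := pselect (C !=set0); last first.
    by exists (F a - 1); [rewrite gtrBl|move=> x Cx; exfalso; apply: noC; exists x].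
  have cC : compact C by exact: subclosed_compact clC (@unitI_compact R) _.
  have [||x] := @compact_EVT_max _ _ F C _ cC; first by exists x0.
    exact: continuous_subspaceT.
  rewrite inE => Cx Fx; exists (F x); first exact: CF.
  by move=> y Cy; apply: Fx; rewrite inE.
(* [m2] separates the values of [F] on [C] from those near [a]. *)
pose m2 := (m1 + F a) / 2.
have [r [r0 ra ra1 Fr]] : exists r, [/\ 0 < r, 0 <= unitI_val a - r,
    unitI_val a + r <= 1 &
    forall x, `|unitI_val a - unitI_val x| < r * 2 -> m2 <= F x].
  have : nbhs a [set x | m2 < F x].
    have m2a : m2 < F a by rewrite /m2; lra.
    apply: (@cF a [set s | m2 < s]); apply: open_nbhs_nbhs.
    by split; [exact: open_gt|].
  rewrite -nbhs_ballE => -[r /= r0 rF].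
  move: a01 => /andP[a0 a1].
  exists (Num.min (r / 2) (Num.min (unitI_val a) (1 - unitI_val a))); split.
  - by rewrite !lt_min divr_gt0//= a0 subr_gt0.
  - by rewrite subr_ge0 !ge_min lexx orbT.
  - by rewrite -lerBrDl !ge_min lexx !orbT.
  - move=> x xr; apply: ltW; apply: rF; rewrite ball_unitIE.
    apply: lt_le_trans xr _; rewrite -ler_pdivlMr// ge_min lexx//.
pose V := @unitI_val R @^-1` `[unitI_val a - r, unitI_val a + r].
have mV : measurable V.
  by rewrite -[X in measurable X]setTI; exact: measurable_unitI_val.
have Vm2 x : V x -> m2 <= F x.
  rewrite /V/= in_itv/= => /andP[? ?]; apply: Fr; rewrite ltr_norml.
  by apply/andP; split; lra.
have Vr : fine (lebesgue01 V) = r * 2.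
  by rewrite lebesgue01_itv//; lra.
have m12 : 0 < m2 - m1 by rewrite /m2; lra.
have r2 : 0 < r * 2 by rewrite mulr_gt0.
near=> b.
have b0 : 0 < b by near: b; exact: nbhs_pinfty_gt.
have bbig : (eps * (r * 2) * (m2 - m1))^-1 <= b.
  by near: b; apply: nbhs_pinfty_ge; rewrite num_real.
have := gibbs_mass_le cF (ltW b0) (Z0 b) (mu0F b0) mC mV Cm1 Vm2.
rewrite Vr -ler_pdivlMr// => /le_trans; apply.
rewrite ler_pdivrMr// -opprB mulrN expRN invf_ple ?posrE ?expR_gt0 ?mulr_gt0//.
apply: le_trans (expR_ge1Dx _).
rewrite invfM ler_pdivrMr// in bbig.
by apply: le_trans bbig _; rewrite lerDr ler01.
Unshelve. all: by end_near. Qed.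

Variables (F1 F2 : unitI R -> R).
Hypothesis dF : is_derivative01 F F1.
Hypothesis dF1 : is_derivative01 F1 F2.

Let G := F \o @clamp01 R.
Let dG r : 0 < r < 1 -> is_derive (r : R) 1 G (F1 (clamp01 r)).
Proof. exact: is_derive_clamp01. Qed.
Let dG1 r : 0 < r < 1 ->
  is_derive (r : R) 1 (F1 \o @clamp01 R) (F2 (clamp01 r)).
Proof. exact: is_derive_clamp01. Qed.

Lemma derive1_at_max_point a : 0 < unitI_val a < 1 -> is_max_point F a ->
  F1 a = 0.
Proof.
move=> a01 maxa.
have := @derive1_at_interior_max R G (F1 \o @clamp01 R) dG _ a01.
by rewrite /= /G/= unitI_valK; apply => r _; exact: maxa.
Qed.

(** As there is at most one other maximizer, [F] is not constant near [a]. *)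
Lemma derive2_at_max_point a a' : 0 < unitI_val a < 1 ->
  (forall x, is_max_point F x <-> x = a \/ x = a') -> F2 a <= 0.
Proof.
move=> a01 maxP.
have maxa : is_max_point F a by apply/maxP; left.
have := @derive2_at_interior_max R G (F1 \o @clamp01 R) (F2 \o @clamp01 R)
  dG dG1 _ a01.
rewrite /G/= unitI_valK; apply; first by move=> r _; exact: maxa.
move=> e e0; set v := unitI_val a in a01 *.
have /andP[v0 v1] := a01.
pose d := Num.min (e / 2) ((1 - v) / 2).
have d0 : 0 < d by rewrite lt_min !divr_gt0// subr_gt0.
have de : d <= e / 2 by rewrite ge_min lexx.
have dv : d <= (1 - v) / 2 by rewrite ge_min lexx orbT.
(* At most one of the points [v + d] and [v + d / 2] is the other maximizer. *)
have strict t : 0 < t -> t <= d -> clamp01 (v + t) <> a' ->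
    F (clamp01 (v + t)) < F a.
  move=> t0 td na'; rewrite lt_neqAle maxa andbT; apply/eqP => Fta.
  have /maxP[/(congr1 (@unitI_val R))|//] : is_max_point F (clamp01 (v + t)).
    by move=> y; rewrite Fta; exact: maxa.
  by rewrite clamp01K -/v; [lra|apply/andP; split; lra].
have [ea'|na'] := pselect (clamp01 (v + d) = a'); last first.
  by exists d; rewrite gtr0_norm//; split; [lra|exact: strict].
exists (d / 2); rewrite gtr0_norm ?divr_gt0//; split; first lra.
apply: strict; [lra|lra|rewrite -ea' => /(congr1 (@unitI_val R))].
by rewrite !clamp01K; [lra|apply/andP; split; lra|apply/andP; split; lra].
Qed.

(** The limit mass around [a] is at least [q], the weight of the limit measure
    at [a]. If [F2 a'] vanishes then [q = 0] (also when [F2 a] vanishes too,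
    by the convention on division by zero). *)
Lemma gibbs_mass_lower a a' (q r eta : R) :
  0 < unitI_val a < 1 -> 0 < unitI_val a' < 1 ->
  (forall x, is_max_point F x <-> x = a \/ x = a') ->
  q = Num.sqrt (- F2 a') / (Num.sqrt (- F2 a) + Num.sqrt (- F2 a')) ->
  0 < r -> 0 < eta ->
  \forall b \near +oo, q - eta <= fine (mu0 b (near_point a r)).
Proof.
move=> a01 a'01 maxP qE r0 eta0.
have maxP' x : is_max_point F x <-> x = a' \/ x = a by rewrite maxP or_comm.
have c0 : 0 <= - F2 a by rewrite oppr_ge0; exact: derive2_at_max_point maxP.
have c'0 : 0 <= - F2 a' by rewrite oppr_ge0; exact: derive2_at_max_point maxP'.
set s := Num.sqrt (- F2 a) in qE; set s' := Num.sqrt (- F2 a') in qE.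
have sE : s ^+ 2 = - F2 a by rewrite sqr_sqrtr.
have s'E : s' ^+ 2 = - F2 a' by rewrite sqr_sqrtr.
have s_ge0 : 0 <= s by exact: sqrtr_ge0.
have : 0 <= s' by exact: sqrtr_ge0.
rewrite le_eqVlt => /predU1P[s'0|s'0].
  near=> b; rewrite qE -s'0 mul0r sub0r.
  by apply: (@le_trans _ _ 0); [rewrite oppr_le0 ltW|exact: fine_ge0].
(* The masses [x] around [a] and [y] around [a'] will satisfy [y <= k x], and
   [x + y] tends to [1]; hence [x] is eventually not much less than
   [1 / (1 + k)], which is close to [q] as [k] exceeds [s / s'] by little. *)
pose k := s / s' + eta / 2.
have k0 : 0 < k by rewrite ltr_wpDl ?divr_ge0 ?divr_gt0// ltW.
have ks : s < k * s'.
  by rewrite mulrDl divfK ?gt_eqF// ltrDl mulr_gt0// divr_gt0.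
have kF2 : k ^+ 2 * F2 (clamp01 (unitI_val a')) < F2 (clamp01 (unitI_val a)).
  rewrite !unitI_valK -ltrN2 -mulrN -sE -s'E -exprMn.
  by rewrite ltr_pXn2r ?nnegrE// mulr_ge0// ltW.
have FE x : G (unitI_val x) = F x by rewrite /G/= unitI_valK.
have maxa : is_max_point F a by apply/maxP; left.
have maxa' : is_max_point F a' by apply/maxP; right.
have Faa' : F a = F a' by apply/eqP; rewrite eq_le maxa maxa'.
have : nbhs (0 : R)
    [set t | G (unitI_val a' + k * t) <= G (unitI_val a + t)].
  apply: (compare_near_critical dG dG1 a01 a'01) => //.
  - by rewrite !FE.
  - by rewrite unitI_valK; exact: derive1_at_max_point.
  - by rewrite unitI_valK; exact: derive1_at_max_point.
rewrite -nbhs_ballE => -[e /= e0 Gle].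
have [d [d0 de dr da da']] : exists d : R, [/\ 0 < d, d < e, d < r,
    0 <= unitI_val a - d /\ unitI_val a + d <= 1 &
    0 <= unitI_val a' - k * d /\ unitI_val a' + k * d <= 1].
  move: a01 a'01 => /andP[a0 a1] /andP[a'0 a'1].
  have H : \forall d \near (0 : R)^'+, [/\ 0 < d, d < e, d < r,
      d < Num.min (unitI_val a) (1 - unitI_val a) &
      d < Num.min (unitI_val a') (1 - unitI_val a') / k].
    near=> d; split; near: d.
    - exact: nbhs_right_gt.
    - exact: nbhs_right_lt.
    - exact: nbhs_right_lt.
    - by apply: nbhs_right_lt; rewrite lt_min a0 subr_gt0.
    - by apply: nbhs_right_lt; rewrite divr_gt0// lt_min a'0 subr_gt0.
  have [d [d0 de dr]] := filter_ex H.
  rewrite ltr_pdivlMr// mulrC !lt_min => /andP[? ?] /andP[? ?].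
  by exists d; split => //; split; lra.
pose U := @unitI_val R @^-1` `[unitI_val a - d, unitI_val a + d].
pose U' := @unitI_val R @^-1` `[unitI_val a' - k * d, unitI_val a' + k * d].
pose C := away_from a d `&` away_from a' (k * d).
have mI (lo hi : R) : measurable (@unitI_val R @^-1` `[lo, hi]).
  by rewrite -[X in measurable X]setTI; exact: measurable_unitI_val.
have mC : measurable C by apply: measurableI; exact: measurable_away_from.
have CF x : C x -> F x < F a.
  move=> [/= xa xa']; rewrite lt_neqAle maxa andbT; apply/eqP => Fx.
  have /maxP[xE|xE] : is_max_point F x by move=> y; rewrite Fx; exact: maxa.
    by move: xa; rewrite /away_from/= xE subrr normr0 leNgt d0.
  by move: xa'; rewrite /away_from/= xE subrr normr0 leNgt mulr_gt0.
have cover : setT `<=` U `|` U' `|` C.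
  move=> x _; have [xa|xa] := leP d `|unitI_val x - unitI_val a|; last first.
    left; left; rewrite /U/= in_itv/=; move: xa; rewrite ltr_norml => /andP[? ?].
    by apply/andP; split; lra.
  have [xa'|xa'] := leP (k * d) `|unitI_val x - unitI_val a'|; first by right.
  left; right; rewrite /U'/= in_itv/=; move: xa'; rewrite ltr_norml => /andP[? ?].
  by apply/andP; split; lra.
have clC : closed C by apply: closedI; exact: closed_away_from.
have eta2 : 0 < eta / 2 by rewrite divr_gt0.
have CH := gibbs_mass_vanishes clC mC a01 CF eta2.
near=> b.
have b0 : 0 < b by near: b; exact: nbhs_pinfty_gt.
have Cb : fine (mu0 b C) <= eta / 2 by near: b.
have U'b : fine (mu0 b U') <= k * fine (mu0 b U).
  have [? ?] := da; have [? ?] := da'.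
  apply: (gibbs_mass_scaled cF (ltW b0) (Z0 b) (mu0F b0)) => //.
  by move=> t td; apply: Gle; rewrite /ball/= sub0r normrN (le_lt_trans td).
have fin A : measurable A -> mu0 b A \is a fin_num.
  by move=> mA; exact: fin_num_measure.
have sum1 : 1 <= fine (mu0 b U) + fine (mu0 b U') + fine (mu0 b C).
  rewrite -lee_fin !EFinD !fineK ?fin//; [|exact: mI|exact: mI].
  rewrite -(@probability_setT _ _ _ (mu0 b)).
  apply: (@le_trans _ _ (mu0 b (U `|` U' `|` C))).
    apply: le_measure; rewrite ?inE//; apply: measurableU => //.
    by apply: measurableU; exact: mI.
  apply: le_trans (measureU2 _ _ _) _ => //; first by apply: measurableU; exact: mI.
  by rewrite leeD2r// measureU2//; exact: mI.
have UV : fine (mu0 b U) <= fine (mu0 b (near_point a r)).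
  apply: fine_le; rewrite ?fin//; [exact: mI|exact: measurable_near_point|].
  apply: le_measure; rewrite ?inE//; [exact: mI|exact: measurable_near_point|].
  move=> x; rewrite /U/= in_itv/= /near_point/= ltr_norml => /andP[? ?].
  by apply/andP; split; lra.
have U1 : fine (mu0 b U) <= 1.
  rewrite -lee_fin fineK; last exact: (fin _ (mI _ _)).
  exact: (probability_le1 _ (mI _ _)).
have U0 : 0 <= fine (mu0 b U) by rewrite fine_ge0.
apply: le_trans UV; move: sum1 U'b Cb U1 U0.
move: (fine (mu0 b U)) (fine (mu0 b U')) (fine (mu0 b C)) => x y c sum1 yx cx x1 x0.
have q0 : 0 < q by rewrite qE divr_gt0// ltr_wpDl.
have q1 : q <= 1 by rewrite qE ler_pdivrMr ?mul1r ?lerDr// ltr_wpDl.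
have qk : q * (1 + s / s') = 1.
  have s'n0 : s' != 0 by rewrite gt_eqF.
  have ss'n0 : s + s' != 0 by rewrite gt_eqF// ltr_wpDl.
  by rewrite qE; field; rewrite s'n0 ss'n0.
have xk : 1 - eta / 2 <= (1 + s / s' + eta / 2) * x.
  by rewrite -addrA -/k; lra.
have := ler_wpM2l (ltW q0) xk.
have -> : q * ((1 + s / s' + eta / 2) * x) =
  q * (1 + s / s') * x + q * (eta / 2) * x by ring.
rewrite qk mul1r.
have : q * (eta / 2) <= eta / 2 by rewrite ler_piMl// ltW.
have : q * (eta / 2) * x <= q * (eta / 2) by rewrite ler_piMr// mulr_ge0// ltW.
lra.
Unshelve. all: by end_near. Qed.

End concentration.

(** * Limits of the masses *)

Section limits.
Variable R : realType.

Lemma cvg_pinfty_of_bounds (u : R -> R) (l : R) :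
  (forall eta, 0 < eta -> \forall b \near +oo, l - eta <= u b) ->
  (forall eta, 0 < eta -> \forall b \near +oo, u b <= l + eta) ->
  u b @[b --> +oo] --> l.
Proof.
move=> lo hi; apply/cvgrPdist_le => eps eps0.
have Lo := lo eps eps0; have Hi := hi eps eps0.
near=> b.
have : l - eps <= u b by near: b.
have : u b <= l + eps by near: b.
by move=> ? ?; rewrite ler_norml; apply/andP; split; lra.
Unshelve. all: by end_near. Qed.

Lemma fine_dirac (a : unitI R) (A : set (unitI R)) :
  fine ((dirac a : {measure set (unitI R) -> \bar R}) A) = (a \in A)%:R.
Proof. exact: (congr1 fine (diracE R a A)). Qed.

Variables (F : unitI R -> R) (mu0 : R -> probability (unitI R) R) (Z : R -> R).
Hypothesis cF : continuous F.
Hypothesis Z0 : forall b, 0 <= Z b.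
Hypothesis mu0F : forall b : R, 0 < b ->
  has_density (mu0 b) (fun a => expR (b * F a) / Z b).

Let m b (A : set (unitI R)) := fine (mu0 b A).

Let m_ge0 b A : 0 <= m b A.
Proof. exact: fine_ge0. Qed.

Let mC b A : measurable A -> m b (~` A) = 1 - m b A.
Proof.
move=> mA; rewrite /m probability_setC// fineB//; exact: fin_num_measure.
Qed.

(** The partition into a small neighbourhood of the maximizer and the rest. *)
Lemma cvg_on_fine_partitions_dirac a : 0 < unitI_val a < 1 ->
  (forall x, is_max_point F x <-> x = a) ->
  cvg_on_fine_partitions mu0 (dirac a).
Proof.
move=> a01 maxP dlt dlt0.
have [r r0 rE] : exists2 r : R, 0 < r & r = dlt / 2.
  by exists (dlt / 2); rewrite ?divr_gt0.
have maxa : is_max_point F a by apply/maxP.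
pose kappa (x : unitI R) := `|unitI_val x - unitI_val a| < r.
have kT : kappa @^-1` [set true] = near_point a r by apply/seteqP; split.
have kF : kappa @^-1` [set false] = away_from a r.
  by rewrite -near_pointC -kT; apply/seteqP; split => x /=; case: (kappa x).
have ina : a \in near_point a r.
  by rewrite inE /near_point/= subrr normr0.
have notina : (a \in away_from a r) = false.
  by rewrite -near_pointC in_setC ina.
have away0 : m b (away_from a r) @[b --> +oo] --> (0 : R).
  apply: cvg_pinfty_of_bounds => eta eta0.
    by apply: nearW => b; rewrite (le_trans _ (m_ge0 _ _))// subr_le0 ltW.
  rewrite add0r; apply: (gibbs_mass_vanishes cF Z0 mu0F (a := a)) => //.
  - exact: closed_away_from.
  - exact: measurable_away_from.
  - move=> x xa; rewrite lt_neqAle maxa andbT; apply/eqP => Fx.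
    have /maxP xE : is_max_point F x by move=> y; rewrite Fx; exact: maxa.
    by move: xa; rewrite /away_from/= xE subrr normr0 leNgt r0.
exists bool, kappa; split.
- by move=> [|]; rewrite ?kT ?kF;
    [exact: measurable_near_point|exact: measurable_away_from].
- move=> [|]; rewrite ?kT ?kF fine_dirac ?ina ?notina; last exact: away0.
  rewrite -[X in _ --> X](subr0 1).
  have -> : (fun b => fine (mu0 b (near_point a r))) =
            (fun b => 1 - m b (away_from a r)).
    apply/funext => b; rewrite -near_pointC mC; last exact: measurable_near_point.
    by rewrite subKr.
  by apply: cvgB; [exact: cvg_cst|exact: away0].
- move=> [|]; [right|by left; rewrite kF fine_dirac notina].
  move=> x y; rewrite /kappa !ltr_norml => /andP[? ?] /andP[? ?].
  by apply/andP; split; lra.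
Qed.

Variables (F1 F2 : unitI R -> R).
Hypothesis dF : is_derivative01 F F1.
Hypothesis dF1 : is_derivative01 F1 F2.

(** The partition into two small disjoint neighbourhoods of the maximizers and
    the rest. The lower bounds for the first two masses are sharp because the
    weights [q] and [q'] add up to [1]. *)
Lemma cvg_on_fine_partitions_dirac2 a a' (q q' : {nonneg R}) :
  0 < unitI_val a -> unitI_val a < unitI_val a' -> unitI_val a' < 1 ->
  (forall x, is_max_point F x <-> x = a \/ x = a') ->
  q%:num = Num.sqrt (- F2 a') / (Num.sqrt (- F2 a) + Num.sqrt (- F2 a')) ->
  q'%:num = Num.sqrt (- F2 a) / (Num.sqrt (- F2 a) + Num.sqrt (- F2 a')) ->
  q%:num + q'%:num = 1 ->
  cvg_on_fine_partitions mu0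
    (measure_add (mscale q (dirac a)) (mscale q' (dirac a'))).
Proof.
move=> a0 aa' a'1 maxP qE q'E qq' dlt dlt0.
have a01 : 0 < unitI_val a < 1 by apply/andP; split; lra.
have a'01 : 0 < unitI_val a' < 1 by apply/andP; split; lra.
pose r := Num.min (dlt / 2) ((unitI_val a' - unitI_val a) / 2).
have r0 : 0 < r by rewrite lt_min !divr_gt0// subr_gt0.
have rd : r <= dlt / 2 by rewrite ge_min lexx.
have ra : r <= (unitI_val a' - unitI_val a) / 2 by rewrite ge_min lexx orbT.
pose B := near_point a r; pose B' := near_point a' r.
have mB : measurable B by exact: measurable_near_point.
have mB' : measurable B' by exact: measurable_near_point.
have BB' : B `&` B' = set0.
  apply/seteqP; split => // x; rewrite /B /B' /near_point/= !ltr_norml.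
  by move=> [/andP[? ?] /andP[? ?]]; exfalso; lra.
have mBB' : measurable (B `|` B') by exact: measurableU.
have mU b : m b (B `|` B') = m b B + m b B'.
  rewrite /m measureU// fineD//; exact: fin_num_measure.
have m1 b : m b B + m b B' <= 1.
  rewrite -mU -lee_fin fineK ?fin_num_measure//; exact: probability_le1.
have lowB : forall eta, 0 < eta -> \forall b \near +oo, q%:num - eta <= m b B.
  by move=> eta eta0; exact: (gibbs_mass_lower cF Z0 mu0F dF dF1 a01 a'01 maxP qE).
have lowB' : forall eta, 0 < eta -> \forall b \near +oo, q'%:num - eta <= m b B'.
  move=> eta eta0; apply: (gibbs_mass_lower cF Z0 mu0F dF dF1 a'01 a01 _ _ r0 eta0).
    by move=> x; rewrite maxP or_comm.
  by rewrite q'E [X in _ / X]addrC.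
have cvgB0 : m b B @[b --> +oo] --> q%:num.
  apply: cvg_pinfty_of_bounds => // eta /lowB' H.
  by apply: filterS H => b; have := m1 b; lra.
have cvgB'0 : m b B' @[b --> +oo] --> q'%:num.
  apply: cvg_pinfty_of_bounds => // eta /lowB H.
  by apply: filterS H => b; have := m1 b; lra.
pose kappa (x : unitI R) : option bool :=
  if `|unitI_val x - unitI_val a| < r then Some true
  else if `|unitI_val x - unitI_val a'| < r then Some false else None.
have kB : kappa @^-1` [set Some true] = B.
  apply/seteqP; split => x; rewrite /kappa /B /near_point/=.
    by case: ifPn => // _; case: ifPn.
  by move=> ->.
have kB' : kappa @^-1` [set Some false] = B'.
  apply/seteqP; split => x; rewrite /kappa /=.
    by case: ifPn => // _; case: ifPn.
  move=> B'x; case: ifPn => [Bx|_]; last by rewrite ifT.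
  by have : (B `&` B') x by []; rewrite BB'.
have kN : kappa @^-1` [set None] = ~` (B `|` B').
  rewrite -kB -kB'; apply/seteqP; split => x /=.
    by move=> ->; case.
  by case: (kappa x) => [[|]|] // H; exfalso; apply: H; [left|right].
pose nu : {measure set (unitI R) -> \bar R} :=
  measure_add (mscale q (dirac a)) (mscale q' (dirac a')).
have nuE A : fine (nu A) = q%:num * (a \in A)%:R + q'%:num * (a' \in A)%:R.
  have -> : nu A = (q%:num%:E * dirac a A + q'%:num%:E * dirac a' A)%E.
    exact: measure_addE.
  by rewrite !diracE -!EFinM -EFinD.
have aB : a \in B by rewrite inE /B /near_point/= subrr normr0.
have a'B' : a' \in B' by rewrite inE /B' /near_point/= subrr normr0.
have aB' : (a \in B') = false.
  apply/negP => /set_mem aB'; have : (B `&` B') a by split => //; exact/set_mem.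
  by rewrite BB'.
have a'B : (a' \in B) = false.
  apply/negP => /set_mem a'B; have : (B `&` B') a' by split => //; exact/set_mem.
  by rewrite BB'.
have nuB : fine (nu B) = q%:num by rewrite nuE aB a'B mulr1 mulr0 addr0.
have nuB' : fine (nu B') = q'%:num by rewrite nuE aB' a'B' mulr1 mulr0 add0r.
have nuN : fine (nu (~` (B `|` B'))) = 0.
  by rewrite nuE !in_setC !in_setU aB a'B' orbT !mulr0 addr0.
exists (option bool), kappa; split.
- by move=> [[|]|]; rewrite ?kB ?kB' ?kN//; exact: measurableC.
- move=> [[|]|]; rewrite -/nu ?kB ?kB' ?kN ?nuB ?nuB' ?nuN//.
  have -> : (fun b => fine (mu0 b (~` (B `|` B')))) =
      (fun b => 1 - (m b B + m b B')).
    by apply/funext => b; rewrite -mU -mC.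
  rewrite -(subrr 1) -[X in _ --> _ - X]qq'.
  by apply: cvgB; [exact: cvg_cst|exact: cvgD].
- move=> [[|]|]; [right|right|by left; rewrite kN].
    move=> x y xi yi.
    have Bx : B x by rewrite -kB.
    have By : B y by rewrite -kB.
    move: Bx By; rewrite /B /near_point/= !ltr_norml => /andP[? ?] /andP[? ?].
    by apply/andP; split; lra.
  move=> x y xi yi.
  have B'x : B' x by rewrite -kB'.
  have B'y : B' y by rewrite -kB'.
  move: B'x B'y; rewrite /B' /near_point/= !ltr_norml => /andP[? ?] /andP[? ?].
  by apply/andP; split; lra.
Qed.

End limits.

Theorem theorem6 (R : realType) (f : Omega R -> R) (fj : nat -> unitI R -> R)
    (F1 F2 : unitI R -> R)
    (mu0 : R -> probability (unitI R) R) (mu : R -> probability (Omega R) R)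
    (f_lipschitz : is_lipschitz f)
    (f_product : is_product_type f fj)
    (fj_iterated : iterated_series_cvg fj)
    (F_derivative : is_derivative01 (on_diagonal f) F1)
    (F1_derivative : is_derivative01 F1 F2)
    (F_continuous : continuous (on_diagonal f))
    (F1_continuous : continuous F1)
    (F2_continuous : continuous F2)
    (mu0_gibbs : forall beta : R, 0 < beta ->
      has_density (mu0 beta) (fun a => expR (beta * on_diagonal f a) /
        \int[lebesgue01 (R:=R)]_b expR (beta * on_diagonal f b)))
    (mu_product : forall beta : R, 0 < beta ->
      is_product_power (mu0 beta) (mu beta)) :
  (forall a1 : unitI R,
     0 < unitI_val a1 < 1 ->
     (forall a, is_max_point (on_diagonal f) a <-> a = a1) ->
     weak_star_cvg mu0 (dirac a1) /\
     (forall mu_infty : probability (Omega R) R,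
        is_product_power (dirac a1) mu_infty -> weak_star_cvg mu mu_infty))
  /\
  (forall a1 a2 : unitI R,
     0 < unitI_val a1 -> unitI_val a1 < unitI_val a2 -> unitI_val a2 < 1 ->
     (forall a, is_max_point (on_diagonal f) a <-> a = a1 \/ a = a2) ->
     F2 a1 != 0 \/ F2 a2 != 0 ->
     exists p1 p2 : {nonneg R},
       [/\ p1%:num + p2%:num = 1,
           F2 a1 != 0 -> p2%:num != 0 /\
             p1%:num / p2%:num = Num.sqrt (F2 a2 / F2 a1),
           F2 a1 = 0 -> p2%:num = 0,
           weak_star_cvg mu0
             (measure_add (mscale p1 (dirac a1)) (mscale p2 (dirac a2))) &
           forall mu_infty : probability (Omega R) R,
             is_product_power
               (measure_add (mscale p1 (dirac a1)) (mscale p2 (dirac a2)))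
               mu_infty ->
             weak_star_cvg mu mu_infty]).
Proof.
pose F := on_diagonal f.
pose Z b := \int[lebesgue01 (R:=R)]_a expR (b * F a).
have Z0 b : 0 <= Z b by apply: Rintegral_ge0 => a _; exact: expR_ge0.
have mu0F (b : R) : 0 < b -> has_density (mu0 b) (fun a => expR (b * F a) / Z b).
  exact: mu0_gibbs.
split=> [a1 a1_int max1|a1 a2 a1_gt0 a12 a2_lt1 max12 F2_neq0].
  have H := cvg_on_fine_partitions_dirac F_continuous Z0 mu0F a1_int max1.
  have dirac1 : (dirac a1 : {measure set (unitI R) -> \bar R}) setT = 1%E.
    exact: diracT.
  split; first exact: (weak_star_cvg_unitI dirac1 H).
  by move=> mu_infty; exact: (weak_star_cvg_Omega dirac1 H mu_product).
have a1_int : 0 < unitI_val a1 < 1 by apply/andP; split; lra.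
have a2_int : 0 < unitI_val a2 < 1 by apply/andP; split; lra.
have max21 x : is_max_point F x <-> x = a2 \/ x = a1 by rewrite max12 or_comm.
have c1 : 0 <= - F2 a1.
  rewrite oppr_ge0.
  exact: (derive2_at_max_point F_derivative F1_derivative a1_int max12).
have c2 : 0 <= - F2 a2.
  rewrite oppr_ge0.
  exact: (derive2_at_max_point F_derivative F1_derivative a2_int max21).
set s1 := Num.sqrt (- F2 a1); set s2 := Num.sqrt (- F2 a2).
have s1_ge0 : 0 <= s1 by exact: sqrtr_ge0.
have s2_ge0 : 0 <= s2 by exact: sqrtr_ge0.
(* [F2] is nonpositive at both maximizers, and nonzero at one of them. *)
have pos (x : R) : 0 <= - x -> x != 0 -> 0 < Num.sqrt (- x).
  by move=> x0 xn0; rewrite sqrtr_gt0 lt_neqAle x0 eq_sym oppr_eq0 xn0.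
have s_gt0 : 0 < s1 + s2.
  by case: F2_neq0 => n0; [rewrite ltr_pwDl ?pos|rewrite ltr_wpDl ?pos].
have s_neq0 : s1 + s2 != 0 by rewrite gt_eqF.
have p1_ge0 : 0 <= s2 / (s1 + s2) by rewrite divr_ge0// ltW.
have p2_ge0 : 0 <= s1 / (s1 + s2) by rewrite divr_ge0// ltW.
pose p1 : {nonneg R} := NngNum p1_ge0; pose p2 : {nonneg R} := NngNum p2_ge0.
have p12 : p1%:num + p2%:num = 1 by rewrite /= -mulrDl addrC divff.
have H := cvg_on_fine_partitions_dirac2 F_continuous Z0 mu0F F_derivative
  F1_derivative a1_gt0 a12 a2_lt1 max12 (q := p1) (q' := p2) erefl erefl p12.
pose nu : {measure set (unitI R) -> \bar R} :=
  measure_add (mscale p1 (dirac a1)) (mscale p2 (dirac a2)).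
have nu1 : nu setT = 1%E.
  have -> : nu setT = (p1%:num%:E * dirac a1 setT + p2%:num%:E * dirac a2 setT)%E.
    exact: measure_addE.
  by rewrite !diracT !mule1 -EFinD p12.
exists p1, p2; split => //=.
- move=> F2a1; have s1_gt0 : 0 < s1 by exact: pos.
  split; first by rewrite gt_eqF// divr_gt0.
  rewrite -[F2 a2 / F2 a1]mulrNN -invrN sqrtrM// sqrtrV//.
  by rewrite invf_div mulrA divfK.
- by move=> F2a1; rewrite /s1 F2a1 oppr0 sqrtr0 mul0r.
- exact: (weak_star_cvg_unitI nu1 H).
- by move=> mu_infty; exact: (weak_star_cvg_Omega nu1 H mu_product).
Qed.
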